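(* Let $(X,f)$ be a topological dynamical system and $x\in X$. If $h_{\mathrm{top}}\big(f|_{\overline{\operatorname{Orb}^{+}(x,f)}}\big)=0$, then the following statements are equivalent: (i) $x$ is distal; (ii) $x$ is $\mathscr{F}_{\mathrm{inf}}\text{-}\mathrm{PR}_0$; (iii) $x$ is $\mathscr{F}_{\mathrm{pubd}}\text{-}\mathrm{PR}_0$; (iv) $x$ is $\mathscr{F}_{\mathrm{ps}}\text{-}\mathrm{PR}_0$.
   Context: $\mathbb{N}=\{1,2,\dots\}$, $\mathbb{N}_0=\{0,1,2,\dots\}$. A topological dynamical system (TDS) is a pair $(X,f)$ with $(X,d)$ a nontrivial (more than one point) compact metric space and $f\colon X\to X$ continuous. $\operatorname{Orb}^{+}(x,f)=\{f^n(x):n\in\mathbb{N}_0\}$, $N_f(x,U)=\{n\in\mathbb{N}: f^n(x)\in U\}$, and $h_{\mathrm{top}}$ is topological entropy. A point $x$ is distal if $\liminf_{n\to\infty}d(f^n(x),f^n(y))>0$ for every $y\in\overline{\operatorname{Orb}^{+}(x,f)}\setminus\{x\}$. A set $A\subseteq\mathbb{N}_0$ is thick if it contains arbitrarily long runs of consecutive integers; syndetic if there is $L\in\mathbb{N}$ with $[i,i+L]\cap A\ne\varnothing$ for all $i\in\mathbb{N}_0$; piecewise syndetic if it is the intersection of a syndetic set and a thick set. Its upper Banach density is $BD^*(A)=\limsup_{n-m\to\infty}\frac{\#(A\cap[m,n])}{n-m+1}$. $\mathscr{F}_{\mathrm{inf}}$, $\mathscr{F}_{\mathrm{pubd}}$,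 $\mathscr{F}_{\mathrm{ps}}$ are the families of infinite subsets, subsets with positive upper Banach density, and piecewise syndetic subsets of $\mathbb{N}_0$, respectively. For such a family $\mathscr{F}$, a point $x$ of $(X,f)$ is $\mathscr{F}$-recurrent if $N_f(x,U)\in\mathscr{F}$ for every neighborhood $U$ of $x$, and recurrent if $N_f(x,U)\neq\varnothing$ for every neighborhood $U$ of $x$. A point $x\in X$ is $\mathscr{F}\text{-}\mathrm{PR}_0$ if for every TDS $(Y,g)$ with zero topological entropy and every $\mathscr{F}$-recurrent point $y\in Y$, the pair $(x,y)$ is recurrent for $(X\times Y,f\times g)$. *)

(* Defs.v *)
From HB Require Import structures.
From mathcomp Require Import all_boot all_order all_algebra finmap.
From mathcomp Require Import all_classical all_reals all_analysis.

Set Implicit Arguments.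
Unset Strict Implicit.
Unset Printing Implicit Defensive.

Import Order.TTheory GRing.Theory Num.Theory.

Local Open Scope classical_set_scope.
Local Open Scope ring_scope.

Definition is_tds (R : realType) (X : metricType R) (f : X -> X) : Prop :=
  [/\ compact [set: X], exists a b : X, a <> b & continuous f].

Definition orbit_plus (X : Type) (f : X -> X) (x : X) : set X :=
  [set iter n f x | n in [set: nat]].

(* [0 < n]: times range over the positive integers. *)
Definition hitting_times (X : Type) (f : X -> X) (x : X) (U : set X) : set nat :=
  [set n | (0 < n)%N /\ U (iter n f x)].

Definition recurrent (X : topologicalType) (f : X -> X) (x : X) : Prop :=
  forall U : set X, nbhs x U -> hitting_times f x U !=set0.

Definition family_recurrent (F : set (set nat)) (X : topologicalType)
    (f : X -> X) (x : X) : Prop :=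
  forall U : set X, nbhs x U -> F (hitting_times f x U).

Definition distal (R : realType) (X : metricType R) (f : X -> X) (x : X) : Prop :=
  forall y, closure (orbit_plus f x) y -> y <> x ->
    (0 < limn_einf (fun n => (mdist (iter n f x) (iter n f y))%:E))%E.

Definition thick (A : set nat) : Prop :=
  forall n : nat, exists m : nat, forall i : nat, (i < n)%N -> A (m + i)%N.

Definition syndetic (A : set nat) : Prop :=
  exists2 L : nat, (0 < L)%N &
    forall i : nat, exists2 j : nat, (i <= j <= i + L)%N & A j.

Definition piecewise_syndetic (A : set nat) : Prop :=
  exists S T : set nat, [/\ syndetic S, thick T & A = S `&` T].

(* The filter of pairs [(m, n)] with [n - m] tending to infinity. *)
Definition length_infty : set_system (nat * nat) :=
  filter_from [set: nat] (fun k => [set p | (p.1 + k <= p.2)%N]).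

Definition upper_banach_density (R : realType) (A : set nat) : \bar R :=
  limf_esup (fun p : nat * nat =>
    (#|` fset_set (A `&` [set i | (p.1 <= i <= p.2)%N])|%:R
      / (p.2 - p.1 + 1)%:R)%:E) length_infty.

Definition F_inf : set (set nat) := [set A | infinite_set A].

Definition F_pubd (R : realType) : set (set nat) :=
  [set A | (0 < upper_banach_density R A)%E].

Definition F_ps : set (set nat) := [set A | piecewise_syndetic A].

(* Bowen's definition of the topological entropy of [f] restricted to an
   invariant compact set [K]: separation is measured by the metric of [X], so
   it is intrinsic to the subsystem [K], and [K] is the whole space for the
   entropy of [f] itself. *)
Definition separated (R : realType) (X : metricType R) (f : X -> X)
    (n : nat) (e : R) (E : set X) : Prop :=
  forall x y, E x -> E y -> x <> y ->
    exists2 i : nat, (i < n)%N & e < mdist (iter i f x) (iter i f y).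

Definition max_separated (R : realType) (X : metricType R) (f : X -> X)
    (K : set X) (n : nat) (e : R) : \bar R :=
  ereal_sup [set (#|` E|%:R)%:E | E in
    [set E : {fset X} | [set` E] `<=` K /\ separated f n e [set` E]]].

Definition separated_growth (R : realType) (X : metricType R) (f : X -> X)
    (K : set X) (e : R) : \bar R :=
  limn_esup (fun n => ((n%:R : R)^-1)%:E * lne (max_separated f K n e))%E.

(* The limit as [e] decreases to 0 is a supremum by monotonicity in [e]. *)
Definition htop_on (R : realType) (X : metricType R) (f : X -> X)
    (K : set X) : \bar R :=
  ereal_sup [set separated_growth f K e | e in [set e : R | 0 < e]].

Definition htop (R : realType) (X : metricType R) (f : X -> X) : \bar R :=
  htop_on f [set: X].

Definition prod_map (X Y : Type) (f : X -> X) (g : Y -> Y) (p : X * Y) : X * Y :=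
  (f p.1, g p.2).

Definition PR0 (F : set (set nat)) (R : realType) (X : metricType R)
    (f : X -> X) (x : X) : Prop :=
  forall (Y : metricType R) (g : Y -> Y), is_tds g -> htop g = 0%E ->
    forall y : Y, family_recurrent F g y -> recurrent (prod_map f g) (x, y).

(* Main.v *)
From HB Require Import structures.
Require Import Defs.
From mathcomp Require Import all_boot all_order all_algebra.
From mathcomp Require Import all_classical all_reals all_analysis.
From mathcomp Require Import finmap zify ring lra.

(* Distality implies product recurrence (Furstenberg): if [y] is recurrent, then
   Ellis' lemma gives an idempotent ultrafilter [p] with p-lim g^n y = y.
   If x' = p-lim f^n x, then also x' = p-lim f^n x', so that [x] and [x'] are
   proximal, x' = x by distality, and (x, y) returns along [p].

   Conversely, let [x] be nondistal. A minimal idempotent [p] provides z <> x in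
   the orbit closure of [x] with p-lim f^n x = z = p-lim f^n z.
   We build a sequence [y] in [0, 1] with y 0 = 1 which is supported, apart from
   time 0, on times [t] at which f^t z, and also f^t x, is close to [z]: then
   (x, y) is not recurrent under the product with the shift. On windows in which
   the orbits of [x] and [z] are close, [y] consists of copies of its own initial
   words, one per window but each in infinitely many windows, placed at those
   times [n], multiples of some M, at which f^n z is near [z], and multiplied by
   a continuous weight of f^n z. Such times are syndetic, hence [y] is piecewise
   syndetically recurrent. As the weights are continuous, a word
   of [y] of length [n] is determined, up to a small error, by an orbit segment of
   [z] of length 3n and by parameters which take polynomially many values, so that
   the zero entropy of the orbit closure of [x] passes to that of [y]. *)

Set Implicit Arguments.
Unset Strict Implicit.
Unset Printing Implicit Defensive.

Import Order.TTheory GRing.Theory Num.Theory.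
Import numFieldNormedType.Exports.

Local Open Scope classical_set_scope.
Local Open Scope ring_scope.

(** * Semigroup filters and Ellis' lemma *)

Definition translate (n : nat) (A : set nat) : set nat := [set m | A (m + n)%N].

Lemma translateS n (A B : set nat) :
  A `<=` B -> translate n A `<=` translate n B.
Proof. by move=> AB m; exact: AB. Qed.

Lemma translateD m n A : translate m (translate n A) = translate (m + n) A.
Proof. by apply/seteqP; split=> k; rewrite /translate /= addnA. Qed.

(* The filter of a closed subsemigroup of the Stone-Cech compactification. *)
Definition semigroup_filter (G : set_system nat) :=
  forall A, G A -> G [set n | G (translate n A)].

(* The filter of a closed left ideal of the Stone-Cech compactification. *)
Definition invariant_filter (G : set_system nat) :=
  forall A, G A -> G (translate 1 A).

Lemma exists_maximal_filter (T : Type) (Q : set_system T -> Prop)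
    (F : set_system T) : ProperFilter F -> Q F ->
  (forall C : set (set_system T), C !=set0 -> total_on C subset ->
    (forall G, C G -> ProperFilter G /\ Q G) -> Q (\bigcup_(G in C) G)) ->
  exists G, [/\ ProperFilter G, Q G, F `<=` G &
    forall H, ProperFilter H -> Q H -> G `<=` H -> H `<=` G].
Proof.
move=> FF QF QU.
(* [Zorn_bigcup] also considers the empty chain, whose union is the empty system; the condition is
   made vacuous there. *)
pose P := [set G : set_system T |
  G !=set0 -> [/\ ProperFilter G, Q G & F `<=` G]].
have [C CP totC|G [PG Gmax]] := @Zorn_bigcup _ P.
  move=> [A [G0 CG0 G0A]].
  pose C' := [set G | C G /\ G !=set0].
  have UC : \bigcup_(G in C) G = \bigcup_(G in C') G.
    apply/seteqP; split=> B [G CG GB]; exists G => //; last by case: CG.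
    by split=> //; exists B.
  have C'0 : C' !=set0 by exists G0; split=> //; exists A.
  have totC' : total_on C' subset.
    by move=> G H [CG _] [CH _]; exact: totC.
  have C'P G : C' G -> [/\ ProperFilter G, Q G & F `<=` G].
    by move=> [/CP PG /PG].
  rewrite UC; split.
  - apply: Build_ProperFilter_ex.
      by move=> B [G /C'P [GF _ _] GB]; exact: (@filter_ex _ _ GF).
    split; first by have [G C'G] := C'0; exists G => //;
      have [GF _ _] := C'P _ C'G; exact: filterT.
    + move=> B1 B2 [G1 C1 GB1] [G2 C2 GB2].
      have [G12|G21] := totC' _ _ C1 C2.
        by exists G2 => //; have [GF _ _] := C'P _ C2; apply: filterI => //;
          exact: G12.
      by exists G1 => //; have [GF _ _] := C'P _ C1; apply: filterI => //;
        exact: G21.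
    + move=> B1 B2 B12 [G CG GB]; exists G => //.
      by have [GF _ _] := C'P _ CG; exact: filterS GB.
  - by apply: QU => // G /C'P [].
  - move=> B FB; have [G CG] := C'0; exists G => //.
    by have [_ _] := C'P _ CG; apply.
have G0 : G !=set0.
  apply: contrapT => nG0; apply: (Gmax F); last by move=> _; split.
  split; first by move=> B GB; case: nG0; exists B.
  by move=> FG; apply: nG0; exists setT; apply: FG; exact: filterT.
have [GF QG FG] := PG G0; exists G; split=> // H HF QH GH B HB.
apply: contrapT => nGB; apply: (Gmax H); last first.
  by move=> _; split=> //; exact: subset_trans GH.
by split=> // HG; apply/nGB/HG.
Qed.

(** Larger filters have smaller closed sets of ultrafilters, so this yields a minimal closed
    subsemigroup. *)
Lemma exists_maximal_semigroup_filter (F : set_system nat) :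
  ProperFilter F -> semigroup_filter F ->
  exists G, [/\ ProperFilter G, semigroup_filter G, F `<=` G &
    forall H, ProperFilter H -> semigroup_filter H -> G `<=` H -> H `<=` G].
Proof.
move=> FF sF; apply: exists_maximal_filter => // C _ _ CP A [G CG GA].
exists G => //; have [GF sG] := CP _ CG.
by apply: filterS (sG _ GA) => n Gn; exists G.
Qed.

(** Likewise, a maximal invariant filter is that of a minimal closed left ideal. *)
Lemma exists_maximal_invariant_filter (F : set_system nat) :
  ProperFilter F -> invariant_filter F ->
  exists G, [/\ ProperFilter G, invariant_filter G, F `<=` G &
    forall H, ProperFilter H -> invariant_filter H -> G `<=` H -> H `<=` G].
Proof.
move=> FF sF; apply: exists_maximal_filter => // C _ _ CP A [G CG GA].
by exists G => //; have [GF] := CP _ CG; exact.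
Qed.

Lemma invariant_translate (G : set_system nat) n A : invariant_filter G ->
  G A -> G (translate n A).
Proof.
move=> iG; elim: n A => [|n IH] A GA.
  rewrite (_ : translate 0 A = A)//.
  by apply/seteqP; split=> m; rewrite /translate /= addn0.
by rewrite -addn1 -translateD; apply/IH/iG.
Qed.

Lemma invariant_semigroup (G : set_system nat) : ProperFilter G ->
  invariant_filter G -> semigroup_filter G.
Proof.
by move=> GF iG A GA; apply: filterE => n; exact: invariant_translate.
Qed.

Lemma ultraC (T : Type) (p : set_system T) (A : set T) : UltraFilter p ->
  ~ p A -> p (~` A).
Proof. by move=> pU; have [] := in_ultra_setVsetC A pU. Qed.

(** The filter of the intersection of two closed sets of ultrafilters. *)
Definition filter_join (T : Type) (G H : set_system T) : set_system T :=
  [set A | exists2 B, G B & exists2 C, H C & B `&` C `<=` A].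

Lemma filter_join_proper (T : Type) (G H : set_system T) :
  ProperFilter G -> ProperFilter H ->
  (forall B C, G B -> H C -> B `&` C !=set0) -> ProperFilter (filter_join G H).
Proof.
move=> GF HF GH; apply: Build_ProperFilter_ex.
  by move=> A [B GB [C HC BCA]]; have [x BCx] := GH _ _ GB HC; exists x;
    exact: BCA.
split.
- by exists setT; [exact: filterT|exists setT => //; exact: filterT].
- move=> A1 A2 [B1 GB1 [C1 HC1 A1s]] [B2 GB2 [C2 HC2 A2s]].
  exists (B1 `&` B2); first exact: filterI.
  exists (C1 `&` C2); first exact: filterI.
  by move=> x [[b1 b2] [c1 c2]]; split; [apply: A1s|apply: A2s].
- move=> A1 A2 A12 [B GB [C HC BCA]]; exists B => //; exists C => //.
  exact: subset_trans A12.
Qed.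

Lemma filter_joinl (T : Type) (G H : set_system T) : ProperFilter H ->
  G `<=` filter_join G H.
Proof.
move=> HF A GA; exists A => //; exists setT; first exact: filterT.
exact: subIsetl.
Qed.

Lemma filter_joinr (T : Type) (G H : set_system T) : ProperFilter G ->
  H `<=` filter_join G H.
Proof.
move=> GF A GA; exists setT; first exact: filterT.
by exists A => //; exact: subIsetr.
Qed.

Lemma filter_join_semigroup (G H : set_system nat) :
  ProperFilter G -> ProperFilter H -> semigroup_filter G ->
  semigroup_filter H -> semigroup_filter (filter_join G H).
Proof.
move=> GF HF sG sH A [B GB [C HC BCA]].
exists [set n | G (translate n B)]; first exact: sG.
exists [set n | H (translate n C)]; first exact: sH.
move=> n [Gn Hn]; exists (translate n B) => //; exists (translate n C) => //.
by move=> m [Bm Cm]; apply: BCA.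
Qed.

(* Ellis' lemma: by maximality of [G], for any ultrafilter [p] finer than [G]
   the products of [G] by [p] and the stabilizer of [p] in [G] are both [G]
   itself, so that [p] is idempotent. *)
Lemma exists_idempotent_ultrafilter (F : set_system nat) :
  ProperFilter F -> semigroup_filter F ->
  exists p, [/\ UltraFilter p, semigroup_filter p & F `<=` p].
Proof.
move=> FF sF; have [G [GF sG FG Gmax]] := exists_maximal_semigroup_filter FF sF.
have [p [pU Gp]] := ultraFilterLemma GF.
have pF : ProperFilter p by exact: ultra_proper.
pose stab A := [set n | p (translate n A)].
(* The filter of the closed set of products [q p], for the ultrafilters [q] finer than [G]. *)
pose Gxp := [set A | G (stab A)].
have stabS A B : A `<=` B -> stab A `<=` stab B.
  by move=> AB n; apply: filterS; exact: translateS.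
have stabI A B : stab A `&` stab B `<=` stab (A `&` B).
  by move=> n [pA pB]; apply: filterS (filterI pA pB).
have stab_translate n A : translate n (stab A) = stab (translate n A).
  by apply/seteqP; split=> m; rewrite /translate /stab /= translateD.
have GxpF : ProperFilter Gxp.
  apply: Build_ProperFilter_ex.
    by move=> A /(@filter_ex _ G)[n]/(@filter_ex _ p)[m Am]; exists (m + n)%N.
  split.
  - by apply: (@filterE _ G) => n; exact: (@filterT _ p).
  - by move=> A B GA GB; apply: (@filterS _ G) (@filterI _ G _ _ _ GA GB); exact: stabI.
  - by move=> A B AB; apply: (@filterS _ G); exact: stabS.
have Gxp_sub : Gxp `<=` G.
  apply: Gmax => //; last first.
    by move=> A GA; apply: filterS (sG _ GA) => n Gn; exact: Gp.
  move=> A GA; rewrite /Gxp /=.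
  have GE : G [set n | G (translate n (stab A))] by exact: sG.
  apply: filterS (sG _ GE) => n /Gp; apply: filterS => m.
  by rewrite /translate /= /Gxp /= -stab_translate.
(* An ultrafilter contains [H] exactly when its product with [p] is [p]. *)
pose H := [set A | exists2 B, p B & stab B `<=` A].
have HF : ProperFilter H.
  apply: Build_ProperFilter_ex.
    move=> A [B pB BA]; suff [n sBn] : stab B !=set0 by exists n; exact: BA.
    apply: contrapT => sB0.
    have /Gxp_sub /Gp : Gxp (~` B).
      apply: (@filterE _ G) => n; apply: ultraC => pn; apply: sB0.
      by exists n.
    by move=> pCB; have [m []] := filter_ex (filterI pB pCB).
  split.
  - by exists setT => //; exact: filterT.
  - move=> A1 A2 [B1 p1 A1s] [B2 p2 A2s]; exists (B1 `&` B2); first exact: filterI.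
    move=> n sn; split; [apply: A1s|apply: A2s]; move: sn; apply: stabS.
      exact: subIsetl.
    exact: subIsetr.
  - by move=> A1 A2 A12 [B pB BA]; exists B => //; exact: subset_trans A12.
have sH : semigroup_filter H.
  move=> A [B pB BA]; exists B => // n pBn; exists (translate n B) => //.
  by rewrite -stab_translate; exact: translateS.
have GH : forall B C, G B -> H C -> B `&` C !=set0.
  move=> B C GB [A pA AC]; apply: contrapT => BC0.
  have /Gxp_sub /Gp pCA : Gxp (~` A).
    apply: filterS GB => n Bn; apply: ultraC => pn.
    by apply: BC0; exists n; split=> //; apply: AC.
  by have [m []] := filter_ex (filterI pA pCA).
have JG : filter_join G H `<=` G.
  apply: Gmax; first exact: filter_join_proper.
  - exact: filter_join_semigroup.
  - exact: filter_joinl.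
exists p; split=> //; last exact: subset_trans Gp.
move=> A pA; apply/Gp/JG/filter_joinr => //.
by exists A.
Qed.

(** * Distal points are product recurrent *)

Lemma limn_einf_gt0P (R : realType) (u : nat -> R) :
  (0 < limn_einf (fun n => (u n)%:E))%E <->
  exists2 d : R, 0 < d & exists N, forall n, (N <= n)%N -> d <= u n.
Proof.
rewrite /limn_einf -/(limf_einf _ _) limf_einfE; split.
  move=> /ereal_sup_gt[_ [V [N _ NV] <-] V0].
  have [d d0 dV] : exists2 d : R, 0 < d &
      (d%:E <= ereal_inf [set (u x)%:E | x in V])%E.
    move: V0; case: (ereal_inf _) => [r||]//=.
      by rewrite lte_fin => r0; exists r.
    by move=> _; exists 1 => //; rewrite leey.
  exists d => //; exists N => n Nn; rewrite -lee_fin (le_trans dV)//.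
  by apply: ereal_inf_lbound; exists n => //; exact: NV.
move=> [d d0 [N dN]]; apply: (@lt_le_trans _ _ d%:E); first by rewrite lte_fin.
apply: le_ereal_sup_tmp.
exists (ereal_inf [set (u x)%:E | x in [set n | (N <= n)%N]]).
  by exists [set n | (N <= n)%N] => //; exists N.
by apply: le_ereal_inf_tmp => _ [n /= Nn <-]; rewrite lee_fin dN.
Qed.

Section metric.
Context {R : realType}.

Lemma cvg_mdistP (T : Type) (X : metricType R) (F : set_system T) (u : T -> X)
    (l : X) : Filter F ->
  (u @ F --> l) <-> (forall e : R, 0 < e -> F [set t | mdist (u t) l < e]).
Proof.
move=> FF; split=> [ul e e0|ul A].
  have : nbhs l (ball l e) by exact: nbhsx_ballx.
  by move=> /ul; apply: (@filterS _ F) => t /=; rewrite ballEmdist /= metric_sym.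
move=> /nbhs_ballP[e /= e0 eA]; apply: (@filterS _ F) (ul e e0) => t ute.
by apply: eA; rewrite ballEmdist /= metric_sym.
Qed.

Lemma continuous_iter (X : topologicalType) (f : X -> X) n :
  continuous f -> continuous (iter n f).
Proof.
move=> cf; elim: n => [|n IH] x; first exact: cvg_id.
by apply: continuous_comp; [exact: IH|exact: cf].
Qed.

Lemma ultra_lim (X : metricType R) (p : set_system nat) (u : nat -> X) :
  compact [set: X] -> UltraFilter p -> exists l : X, u @ p --> l.
Proof.
move=> cX pU; have [|l [_ ul]] := cX (u @ p); first exact: filterT.
exists l => A Al; apply: contrapT => npA.
have pnA := ultraC pU npA.
by have [x []] := ul _ _ (pnA : (u @ p) (~` A)) Al.
Qed.

(** By the semigroup property, for p-most [n], [f^(m+n) x] is near [x'] for p-most [m]; by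
    continuity it tends to [f^n x'] along [m]. *)
Lemma semigroup_lim (X : metricType R) (f : X -> X) (p : set_system nat)
    (x x' : X) : continuous f -> ProperFilter p -> semigroup_filter p ->
  iter n f x @[n --> p] --> x' -> iter n f x' @[n --> p] --> x'.
Proof.
move=> cf pF sp xx'; apply/cvg_mdistP => e e0.
have e20 : 0 < e / 2 by rewrite divr_gt0.
move/cvg_mdistP: (xx') => /(_ _ e20) /sp; apply: filterS => n /= pn.
have : iter n f (iter m f x) @[m --> p] --> iter n f x'.
  by apply: continuous_cvg => //; exact: (continuous_iter cf).
move=> /cvg_mdistP /(_ _ e20) pn'.
have [m [+ +]] := filter_ex (filterI pn pn').
rewrite /translate /= addnC iterD => m1 m2.
rewrite (splitr e) (le_lt_trans (metric_triangle _ (iter n f (iter m f x)) _))//.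
by rewrite ltrD// metric_sym.
Qed.

(** A principal idempotent, concentrated on [N], would satisfy [N + N = N], which positivity
    excludes. *)
Lemma semigroup_ge (p : set_system nat) : UltraFilter p -> semigroup_filter p ->
  p [set n | (0 < n)%N] -> forall N, p [set n | (N <= n)%N].
Proof.
move=> pU sp p0; elim=> [|N IH]; first exact: filterE.
have [->//|N0] := eqVneq N 0%N.
apply: contrapT => /ultraC nN.
have pN : p [set N].
  apply: filterS (filterI IH nN) => n /= [Nn] /negP; rewrite -leqNgt => nN'.
  by apply/eqP; rewrite eqn_leq Nn nN'.
have [n [-> /= pt]] := filter_ex (filterI pN (sp _ pN)).
have [m [/= mN]] := filter_ex (filterI pt p0).
by move: mN; rewrite /translate /=; lia.
Qed.

(* The filter of the closed set of all ultrafilters [p] on the positive integers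
   such that p-lim f^n x = y. *)
Definition return_filter (X : topologicalType) (f : X -> X) (x y : X) :
    set_system nat :=
  [set A | exists2 U, nbhs y U & hitting_times f x U `<=` A].

Lemma return_filter_proper (X : topologicalType) (f : X -> X) (x y : X) :
  (forall U, nbhs y U -> hitting_times f x U !=set0) ->
  ProperFilter (return_filter f x y).
Proof.
move=> xy; apply: Build_ProperFilter_ex.
  by move=> A [U Uy UA]; have [n xU] := xy _ Uy; exists n; exact: UA.
split.
- by exists setT => //; exact: filterT.
- move=> A B [U Uy UA] [V Vy VB]; exists (U `&` V); first exact: filterI.
  by move=> n [n0 [Un Vn]]; split; [apply: UA|apply: VB].
- by move=> A B AB [U Uy UA]; exists U => //; exact: subset_trans AB.
Qed.

(** If [f^n y] lies in an open [V], the preimage of [V] by [f^n] is a neighborhood of [y], and a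
    return to it at time [m] is a return to [V] at time [m + n]. *)
Lemma return_filter_semigroup (X : topologicalType) (f : X -> X) (y : X) :
  continuous f -> semigroup_filter (return_filter f y y).
Proof.
move=> cf A [U]; rewrite nbhsE => -[V [oV Vy] VU] UA.
exists V; first exact: open_nbhs_nbhs.
move=> n [n0 Vn].
exists (iter n f @^-1` V).
  by apply: (continuous_iter cf); exact: open_nbhs_nbhs.
move=> m [m0 Vm]; apply: UA; split; first by rewrite addn_gt0 m0.
by apply: VU; rewrite addnC iterD.
Qed.

Lemma return_filter_cvg (X : topologicalType) (f : X -> X) (x y : X)
    (p : set_system nat) : Filter p ->
  return_filter f x y `<=` p -> iter n f x @[n --> p] --> y.
Proof.
move=> pF rp U Uy; apply: (@filterS _ p _ (hitting_times f x U)); last apply: rp.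
  by move=> n [].
by exists U.
Qed.

Lemma closure_orbit_lim (X : topologicalType) (f : X -> X) (x y : X)
    (p : set_system nat) : ProperFilter p ->
  iter n f x @[n --> p] --> y -> closure (orbit_plus f x) y.
Proof.
move=> pF xy U /xy pU; have [n Un] := filter_ex (pU : p _).
by exists (iter n f x); split=> //; exists n.
Qed.

Lemma distal_product_recurrent (X : metricType R) (f : X -> X) (x : X)
    (Y : metricType R) (g : Y -> Y) (y : Y) :
  compact [set: X] -> continuous f -> continuous g ->
  distal f x -> recurrent g y -> recurrent (prod_map f g) (x, y).
Proof.
move=> cX cf cg dx ry.
have GF := return_filter_proper ry.
have [p [pU sp Gp]] :=
  exists_idempotent_ultrafilter GF (return_filter_semigroup (y := y) cg).
have pF : ProperFilter p by exact: ultra_proper.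
have p0 : p [set n | (0 < n)%N].
  by apply: Gp; exists setT; [exact: filterT|move=> n []].
have yy := return_filter_cvg _ Gp.
have [x' xx'] := ultra_lim (fun n => iter n f x) cX pU.
have x'x' := semigroup_lim cf pF sp xx'.
have {}xx' : iter n f x @[n --> p] --> x.
  have [<-//|/eqP x'x] := eqVneq x' x.
  have /limn_einf_gt0P[d d0 [N dN]] := dx _ (closure_orbit_lim pF xx') x'x.
  have d20 : 0 < d / 2 by rewrite divr_gt0.
  move/cvg_mdistP: xx' => /(_ _ d20) p1; move/cvg_mdistP: x'x' => /(_ _ d20) p2.
  have [n [[/= n1 n2] n3]] :=
    filter_ex (filterI (filterI p1 p2) (semigroup_ge pU sp p0 N)).
  have := dN _ n3; rewrite leNgt => /negP; case.
  rewrite (splitr d) (le_lt_trans (metric_triangle _ x' _))//.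
  by rewrite ltrD// metric_sym.
move=> U -[[U1 U2] /= [U1x U2y] U12].
have pU1 : p [set n | U1 (iter n f x)] by exact: xx'.
have pU2 : p [set n | U2 (iter n g y)] by exact: yy.
have [n [[n1 n2] n0]] := filter_ex (filterI (filterI pU1 pU2) p0).
exists n; split=> //; apply: U12.
suff -> : iter n (prod_map f g) (x, y) = (iter n f x, iter n g y) by [].
by elim: n {n0 n1 n2} => //= n ->.
Qed.

End metric.

(** * Families of subsets of the integers *)

(** A set of [N] elements has density at most [N / k.+1] in intervals of at least [k.+1]
    integers. *)
Lemma F_pubd_inf (R : realType) : F_pubd R `<=` F_inf.
Proof.
move=> A /= BDA finA.
pose N := #|` fset_set A|.
have BDle k : (upper_banach_density R A <= (N%:R / k.+1%:R)%:E)%E.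
  apply: le_trans (_ : (ereal_sup
      [set (#|` fset_set (A `&` [set i | (p.1 <= i <= p.2)%N])|%:R
        / (p.2 - p.1 + 1)%:R)%:E |
        p in [set p : nat * nat | (p.1 + k <= p.2)%N]] <= _)%E).
    apply: ereal_inf_lbound => /=.
    by exists [set p | (p.1 + k <= p.2)%N] => //; exists k.
  apply: ge_ereal_sup => _ [[m n] /= mn <-]; rewrite lee_fin.
  have cA : (#|` fset_set (A `&` [set i | (m <= i <= n)%N])| <= N)%N.
    apply: fsubset_leq_card; rewrite -fset_set_sub //.
    exact: finite_setIl.
  apply: ler_pM; rewrite ?invr_ge0 ?ler_nat//.
  by rewrite lef_pV2 ?posrE ?ltr0n ?addn1// ler_nat; lia.
have : (upper_banach_density R A <= 0)%E; last by rewrite leNgt BDA.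
apply/lee_addgt0Pr => e e0; rewrite add0e.
have [k kN] : exists k : nat, N%:R / e < k%:R.
  by exists (Num.bound (N%:R / e)); rewrite archi_boundP // divr_ge0 // ltW.
apply: le_trans (BDle k) _; rewrite lee_fin ler_pdivrMr ?ltr0n// mulrC -ler_pdivrMr//.
by rewrite (le_trans (ltW kN))// ler_nat.
Qed.

(** A long run of [T] splits into blocks of [L.+1] integers, each of which contains a point of [S]:
    the density is at least [1 / L.+1]. *)
Lemma F_ps_pubd (R : realType) : F_ps `<=` F_pubd R.
Proof.
move=> A [S [T [[L L0 SL] tT AST]]] /=.
suff : ((L.+1%:R^-1)%:E <= upper_banach_density R A)%E.
  by apply: lt_le_trans; rewrite lte_fin invr_gt0.
apply: le_ereal_inf_tmp => _ [V [k _ kV] <-].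
have [m mT] := tT (k.+1 * L.+1)%N.
have [s sP] : {s : nat -> nat & forall q,
    (m + q * L.+1 <= s q <= m + q * L.+1 + L)%N /\ S (s q)}.
  apply: (@choice _ _ (fun q j =>
    (m + q * L.+1 <= j <= m + q * L.+1 + L)%N /\ S j)) => q.
  by have [j j1 j2] := SL (m + q * L.+1)%N; exists j.
pose n := (m + (k.+1 * L.+1).-1)%N.
apply: (@le_trans _ _ (#|` fset_set (A `&` [set i | (m <= i <= n)%N])|%:R
      / (n - m + 1)%:R)%:E); last first.
  apply: ereal_sup_ubound; exists (m, n) => //; apply: kV => /=.
  by rewrite /n; nia.
have nmE : (n - m + 1 = k.+1 * L.+1)%N by rewrite /n; nia.
rewrite lee_fin nmE natrM invfM mulrA.
rewrite ler_peMl ?invr_ge0// ler_pdivlMr ?ltr0n// mul1r ler_nat.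
have finI : finite_set (A `&` [set i | (m <= i <= n)%N]).
  apply: finite_setIr; apply: (sub_finite_set _ (finite_II n.+1)).
  by move=> i /= /andP[_]; rewrite ltnS.
rewrite -[leqLHS](size_iota 0) -(size_map s); apply: uniq_leq_size.
  rewrite map_inj_uniq ?iota_uniq// => a b sab.
  have [/andP[a1 a2] _] := sP a; have [/andP[b1 b2] _] := sP b.
  by move: a1 a2; rewrite sab => a1 a2; nia.
move=> _ /mapP[q + ->]; rewrite mem_iota add0n /= ltnS => qk.
have [/andP[q1 q2] Sq] := sP q.
rewrite in_fset_set//; apply/mem_set; split; last by rewrite /= /n; nia.
rewrite AST; split=> //.
rewrite -(subnKC (n := s q) (m := m)); last by nia.
by apply: mT; nia.
Qed.

Lemma PR0S (F G : set (set nat)) (R : realType) (X : metricType R)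
    (f : X -> X) (x : X) : F `<=` G -> PR0 G f x -> PR0 F f x.
Proof. by move=> FG Gx Y g tg hg y Fy; apply: Gx => // U /Fy /FG. Qed.

(** * Minimal idempotents and nondistal points *)

Lemma filter_join_invariant (G H : set_system nat) :
  invariant_filter G -> invariant_filter H -> invariant_filter (filter_join G H).
Proof.
move=> iG iH A [B GB [C HC BCA]].
exists (translate 1 B); first exact: iG.
exists (translate 1 C); first exact: iH.
by move=> n [Bn Cn]; apply: BCA.
Qed.

Lemma ultra_bigcup (T : Type) (p : set_system T) (B : nat -> set T) l :
  UltraFilter p -> p [set t | exists2 i, (i < l)%N & B i t] ->
  exists2 i, (i < l)%N & p (B i).
Proof.
move=> pU pB; apply: contrapT => nB.
have : p [set t | forall i, (i < l)%N -> ~ B i t].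
  elim: l {pB} nB => [|l IH] nB; first by apply: filterE.
  have pl : p (~` B l) by apply: ultraC => pl; apply: nB; exists l.
  have pl' : p [set t | forall i, (i < l)%N -> ~ B i t].
    by apply: IH => -[i il pi]; apply: nB; exists i => //; exact: ltnW.
  apply: filterS (filterI pl pl') => t [Blt Bt] i.
  by rewrite ltnS leq_eqVlt => /orP[/eqP->|/Bt].
by move=> /(filterI pB)/filter_ex[t [[i il Bi]]] /(_ _ il).
Qed.

(** Otherwise the sets [W l] of starting points of runs of length [l] missing [A] meet every member
    of [L]. They generate an invariant filter, so maximality puts the complement of [A] in [L],
    hence in [p]. *)
Lemma maximal_invariant_bigcup (L p : set_system nat) (A : set nat) :
  ProperFilter L -> invariant_filter L ->
  (forall H, ProperFilter H -> invariant_filter H -> L `<=` H -> H `<=` L) ->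
  UltraFilter p -> L `<=` p -> p A ->
  exists l, L [set n | exists2 i, (i < l)%N & A (n + i)%N].
Proof.
move=> LF iL Lmax pU Lp pA; apply: contrapT => nL.
pose W l := [set n | forall i, (i < l)%N -> ~ A (n + i)%N].
pose H := [set C | exists l, W l `<=` C].
have LW B l : L B -> B `&` W l !=set0.
  move=> LB; apply: contrapT => BW0; apply: nL; exists l.
  apply: filterS LB => n Bn; apply: contrapT => nA; apply: BW0.
  by exists n; split=> // i il Ai; apply: nA; exists i.
have HF : ProperFilter H.
  apply: Build_ProperFilter_ex.
    move=> C [l WC]; have [n [_ Wn]] := LW _ l filterT.
    by exists n; exact: WC.
  split.
  - by exists 0%N.
  - move=> C D [l WC] [k WD]; exists (maxn l k) => n Wn.
    by split; [apply: WC|apply: WD] => i il; apply: Wn; lia.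
  - by move=> C D CD [l WC]; exists l; exact: subset_trans CD.
have iH : invariant_filter H.
  move=> C [l WC]; exists l.+1 => n Wn; apply: WC => i il.
  by rewrite -addnA add1n; exact: Wn.
have : L (~` A).
  apply: (Lmax (filter_join L H)).
  - apply: filter_join_proper => B C LB [l WC].
    by have [n [Bn Wn]] := LW _ l LB; exists n; split=> //; exact: WC.
  - exact: filter_join_invariant.
  - exact: filter_joinl.
  - apply: filter_joinr; exists 1%N => n /(_ 0%N); rewrite addn0.
    by move=> /(_ isT).
by move=> /Lp /(filterI pA) /filter_ex [n []].
Qed.

(** By invariance of [L], for each [n] the union of the translates of [A] by [n + i], for [i < l],
    is in [p]; hence so is one of them. *)
Lemma minimal_syndetic (L p : set_system nat) (A : set nat) :
  ProperFilter L -> invariant_filter L ->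
  (forall H, ProperFilter H -> invariant_filter H -> L `<=` H -> H `<=` L) ->
  UltraFilter p -> L `<=` p -> p A -> syndetic [set n | p (translate n A)].
Proof.
move=> LF iL Lmax pU Lp pA.
have [l Ll] := maximal_invariant_bigcup LF iL Lmax pU Lp pA.
exists l.+1 => // n.
have [|i il pi] := @ultra_bigcup _ p (fun i => translate (n + i) A) l pU.
  apply: filterS (Lp _ (invariant_translate n iL Ll)) => m [i il].
  by exists i => //; rewrite /translate /= addnA.
by exists (n + i)%N => //; rewrite leq_addr leq_add2l ltnW// ltnS ltnW.
Qed.

(** The residue class [c] modulo [M] selected by [p] satisfies [c + c = c]. *)
Lemma semigroup_dvdn (p : set_system nat) M : UltraFilter p ->
  semigroup_filter p -> (0 < M)%N -> p [set n | (M %| n)%N].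
Proof.
move=> pU sp M0.
have [|c cM pc] := @ultra_bigcup _ p (fun c => [set n | (n %% M)%N = c]) M pU.
  by apply: filterE => n; exists (n %% M)%N => //; rewrite ltn_mod.
have [n [/= nc pn]] := filter_ex (filterI pc (sp _ pc)).
apply: filterS pn => m; rewrite /translate /= => mc.
rewrite /dvdn; apply/eqP/esym/eqP; rewrite -(mod0n M) -(eqn_modDr n) add0n.
by rewrite nc mc eqxx.
Qed.

Section metric.
Context {R : realType}.

(** Heine-Cantor: along an ultrafilter, both coordinates of a sequence of ever closer
    counterexamples converge to the same point. *)
Lemma compact_uniformly_continuous (X : metricType R) (f : X -> X) :
  compact [set: X] -> continuous f -> forall e : R, 0 < e ->
  exists2 d : R, 0 < d & forall a b, mdist a b < d -> mdist (f a) (f b) < e.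
Proof.
move=> cX cf e e0; apply: contrapT => nd.
have [ab abP] : {ab : nat -> X * X & forall n,
    mdist (ab n).1 (ab n).2 < n.+1%:R^-1 /\
    e <= mdist (f (ab n).1) (f (ab n).2)}.
  apply: (@choice _ _ (fun n c => mdist c.1 c.2 < n.+1%:R^-1 /\
    e <= mdist (f c.1) (f c.2))) => n.
  apply: contrapT => nab; apply: nd; exists n.+1%:R^-1; first by rewrite invr_gt0.
  move=> a b abn; rewrite ltNge; apply/negP => fab; apply: nab.
  by exists (a, b).
have [p [pU op]] := ultraFilterLemma (@eventually_filter).
have pF : ProperFilter p by exact: ultra_proper.
have [a aP] := ultra_lim (fun n => (ab n).1) cX pU.
have bP : (ab n).2 @[n --> p] --> a.
  apply/cvg_mdistP => d d0.
  have d20 : 0 < d / 2 by rewrite divr_gt0.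
  move/cvg_mdistP : aP => /(_ _ d20) pa.
  have pn : p [set n | n.+1%:R^-1 < d / 2].
    apply: op; exists (Num.bound (d / 2)^-1) => // n /= nd2.
    rewrite invf_plt ?posrE ?ltr0n//.
    rewrite (lt_le_trans (archi_boundP _)) ?invr_ge0 ?(ltW d20)//.
    by rewrite ler_nat leqW.
  apply: filterS (filterI pa pn) => n [/= n1 n2].
  rewrite (splitr d) (le_lt_trans (metric_triangle _ (ab n).1 _))// ltrD//.
  by rewrite metric_sym (lt_trans _ n2)//; have [] := abP n.
have fa : f (ab n).1 @[n --> p] --> f a by apply: continuous_cvg => //; exact: cf.
have fb : f (ab n).2 @[n --> p] --> f a by apply: continuous_cvg => //; exact: cf.
have e20 : 0 < e / 2 by rewrite divr_gt0.
move/cvg_mdistP : fa => /(_ _ e20) fa; move/cvg_mdistP : fb => /(_ _ e20) fb.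
have [n [/= n1 n2]] := filter_ex (filterI fa fb).
have [_] := abP n; rewrite leNgt => /negP; apply.
rewrite (splitr e) (le_lt_trans (metric_triangle _ (f a) _))// ltrD//.
by rewrite metric_sym.
Qed.

Lemma iter_close (X : metricType R) (f : X -> X) :
  compact [set: X] -> continuous f -> forall (e : R) l, 0 < e ->
  exists2 d : R, 0 < d & forall a b, mdist a b < d ->
    forall i, (i < l)%N -> mdist (iter i f a) (iter i f b) < e.
Proof.
move=> cX cf e l e0; elim: l => [|l [d d0 dP]]; first by exists 1.
have [d' d'0 d'P] :=
  compact_uniformly_continuous cX (continuous_iter (n := l) cf) e0.
exists (Num.min d d'); first by rewrite lt_min d0.
move=> a b; rewrite lt_min => /andP[ad ad'] i.
by rewrite ltnS leq_eqVlt => /orP[/eqP->|il]; [exact: d'P|exact: dP].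
Qed.

(** Let [A] be the set of multiples [m] of [M] with [f^m z] near [z]. If [m + j] is in [A] for
    p-most [m], then [M] divides [j], and [f^j z], the p-limit of [f^(m+j) z], is near [z]. *)
Lemma idempotent_syndetic (X : metricType R) (f : X -> X) (z : X)
    (L p : set_system nat) : continuous f ->
  ProperFilter L -> invariant_filter L ->
  (forall H, ProperFilter H -> invariant_filter H -> L `<=` H -> H `<=` L) ->
  UltraFilter p -> semigroup_filter p -> L `<=` p ->
  iter n f z @[n --> p] --> z ->
  forall M (e : R), (0 < M)%N -> 0 < e ->
    syndetic [set n | (M %| n)%N /\ mdist (iter n f z) z < e].
Proof.
move=> cf LF iL Lmax pU sp Lp zz M e M0 e0.
have e20 : 0 < e / 2 by rewrite divr_gt0.
move/cvg_mdistP : (zz) => /(_ _ e20) pz.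
have pM := semigroup_dvdn pU sp M0.
have [l l0 Sl] := minimal_syndetic LF iL Lmax pU Lp (filterI pM pz).
exists l => // i; have [j ij pj] := Sl i; exists j => //.
have : iter j f (iter m f z) @[m --> p] --> iter j f z.
  by apply: continuous_cvg => //; exact: (continuous_iter cf).
move=> /cvg_mdistP /(_ _ e20) pj'.
have [m [[[/= Mmj m1]] m2] m3] := filter_ex (filterI (filterI pj pj') pM).
split; first by rewrite -(dvdn_addr j m3).
rewrite (splitr e) (le_lt_trans (metric_triangle _ (iter j f (iter m f z)) _))//.
apply: ltrD; first by rewrite metric_sym.
by rewrite -iterD addnC.
Qed.

(** Let [z0] violate distality and [p] be a minimal idempotent along which [x] and [z0] are
    proximal. The p-limit of [f^n x] serves as [z] unless it is [x]; in that case [z0] itself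
    serves, with another idempotent [q] of the same left ideal. *)
Lemma nondistal_witness (X : metricType R) (f : X -> X) (x : X) :
  compact [set: X] -> continuous f -> ~ distal f x ->
  exists z, [/\ z <> x, closure (orbit_plus f x) z,
    forall (e : R) N l, 0 < e -> exists2 m, (N <= m)%N &
      forall i, (i < l)%N -> mdist (iter (m + i) f x) (iter (m + i) f z) < e &
    forall M (e : R), (0 < M)%N -> 0 < e ->
      syndetic [set n | (M %| n)%N /\ mdist (iter n f z) z < e]].
Proof.
move=> cX cf /existsNP[z0 /not_implyP[cz0 /not_implyP[z0x nlim]]].
have prox (d : R) N : 0 < d ->
    exists2 n, (N <= n)%N & mdist (iter n f x) (iter n f z0) < d.
  move=> d0; apply: contrapT => nprox; apply: nlim; apply/limn_einf_gt0P.
  exists d => //; exists N => n Nn; rewrite leNgt; apply/negP => nd.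
  by apply: nprox; exists n.
(* The filter of the left ideal of proximality of [x] and [z0]; its invariance comes from uniform
   continuity. *)
pose F0 := [set A | exists d : R, 0 < d /\ exists N, forall n, (N <= n)%N ->
  mdist (iter n f x) (iter n f z0) < d -> A n].
have F0F : ProperFilter F0.
  apply: Build_ProperFilter_ex.
    move=> A [d [d0 [N NA]]]; have [n Nn nd] := prox d N d0.
    by exists n; exact: NA.
  split.
  - by exists 1; split=> //; exists 0%N.
  - move=> A B [d [d0 [N NA]]] [e [e0 [K KB]]].
    exists (Num.min d e); split; first by rewrite lt_min d0.
    exists (maxn N K) => n; rewrite geq_max => /andP[Nn Kn].
    by rewrite lt_min => /andP[nd ne]; split; [exact: NA|exact: KB].
  - move=> A B AB [d [d0 [N NA]]]; exists d; split=> //; exists N => n Nn nd.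
    by apply: AB; exact: NA.
have iF0 : invariant_filter F0.
  move=> A [d [d0 [N NA]]].
  have [e e0 eP] := compact_uniformly_continuous cX cf d0.
  exists e; split=> //; exists N => n Nn ne; apply: NA.
    by rewrite addn1 leqW.
  by rewrite addn1 /=; exact: eP.
have [L [LF iL F0L Lmax]] := exists_maximal_invariant_filter F0F iF0.
have Lprox (d : R) : 0 < d -> L [set n | mdist (iter n f x) (iter n f z0) < d].
  by move=> d0; apply: F0L; exists d; split=> //; exists 0%N.
have L0 : L [set n | (0 < n)%N].
  by apply: F0L; exists 1; split=> //; exists 1%N.
have [p [pU sp Lp]] := exists_idempotent_ultrafilter LF (invariant_semigroup LF iL).
suff [z [q [qU sq Lq zx xz]]] : exists z q, [/\ UltraFilter q,
    semigroup_filter q, L `<=` q, z <> x & iter n f x @[n --> q] --> z].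
  have qF : ProperFilter q by exact: ultra_proper.
  have zz := semigroup_lim cf qF sq xz.
  exists z; split=> //; first exact: closure_orbit_lim xz.
    move=> e N l e0.
    have [d d0 dP] := iter_close cX cf l e0.
    have d20 : 0 < d / 2 by rewrite divr_gt0.
    move/cvg_mdistP : xz => /(_ _ d20) q1.
    move/cvg_mdistP : (zz) => /(_ _ d20) q2.
    have q3 := semigroup_ge qU sq (Lq _ L0) N.
    have [m [[/= m1 m2] m3]] := filter_ex (filterI (filterI q1 q2) q3).
    exists m => // i il; rewrite addnC !iterD; apply: dP => //.
    rewrite (splitr d) (le_lt_trans (metric_triangle _ z _))// ltrD//.
    by rewrite metric_sym.
  by move=> M e M0 e0; exact: (idempotent_syndetic cf LF iL Lmax qU sq Lq zz M0 e0).
have pF : ProperFilter p by exact: ultra_proper.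
have [z1 xz1] := ultra_lim (fun n => iter n f x) cX pU.
have [z1x|/eqP z1x] := eqVneq z1 x; last by exists z1, p; split.
rewrite {}z1x in xz1.
(* Some [f^m x] is near [z0]. As [p] returns [x] to itself, [f^(n+m) x] is near [f^m x] for p-most
   [n], and it is near [f^(n+m) z0] by proximality. *)
have LG A U : L A -> nbhs z0 U -> A `&` hitting_times f z0 U !=set0.
  move=> LA /nbhs_ballP[e /= e0 eU].
  have e30 : 0 < e / 3 by rewrite divr_gt0.
  have [_ [[m _ <-]]] := cz0 _ (nbhsx_ballx z0 _ e30).
  rewrite ballEmdist /= metric_sym => m1.
  have : iter m f (iter n f x) @[n --> p] --> iter m f x.
    by apply: continuous_cvg => //; exact: (continuous_iter cf).
  move=> /cvg_mdistP /(_ _ e30) p1.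
  have LA' : L (A `&` [set n | mdist (iter n f x) (iter n f z0) < e / 3] `&`
      [set n | (0 < n)%N]).
    by apply: filterI => //; apply: filterI => //; exact: Lprox.
  have p2 := Lp _ (invariant_translate m iL LA').
  have [n [/= n1 [[n2 n3] n4]]] := filter_ex (filterI p1 p2).
  exists (n + m)%N; split=> //; split=> //; apply: eU.
  rewrite ballEmdist /= metric_sym.
  have -> : e = e / 3 + (e / 3 + e / 3) by field.
  rewrite (le_lt_trans (metric_triangle _ (iter (n + m) f x) _))// ltrD//.
    by rewrite metric_sym.
  rewrite (le_lt_trans (metric_triangle _ (iter m f x) _))// ltrD//.
  by rewrite addnC iterD.
have rF : ProperFilter (return_filter f z0 z0).
  by apply: return_filter_proper => U /(LG _ _ filterT) [n [_ zn]]; exists n.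
have JF : ProperFilter (filter_join L (return_filter f z0 z0)).
  apply: filter_join_proper => B C LB [U Uz UC].
  by have [n [Bn Un]] := LG _ _ LB Uz; exists n; split=> //; exact: UC.
have [q [qU sq Jq]] : exists q, [/\ UltraFilter q, semigroup_filter q &
    filter_join L (return_filter f z0 z0) `<=` q].
  apply: exists_idempotent_ultrafilter => //; apply: filter_join_semigroup => //.
    exact: invariant_semigroup.
  exact: return_filter_semigroup.
have qF : ProperFilter q by exact: ultra_proper.
have Lq : L `<=` q by apply: subset_trans Jq; exact: filter_joinl.
have zz : iter n f z0 @[n --> q] --> z0.
  by apply: return_filter_cvg; apply: subset_trans Jq; exact: filter_joinr.
exists z0, q; split=> //; apply/cvg_mdistP => e e0.
have e20 : 0 < e / 2 by rewrite divr_gt0.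
move/cvg_mdistP : zz => /(_ _ e20) q1.
apply: filterS (filterI q1 (Lq _ (Lprox _ e20))) => n [/= n1 n2].
by rewrite (splitr e) (le_lt_trans (metric_triangle _ (iter n f z0) _))// addrC ltrD.
Qed.

End metric.

(** * Separated and spanning sets *)

Section entropy.
Context {R : realType}.

Lemma limn_esup_lt (u : nat -> \bar R) (a : \bar R) : (limn_esup u < a)%E ->
  exists N, forall n, (N <= n)%N -> (u n < a)%E.
Proof.
move=> /ereal_inf_lt [_ [V [N _ NV] <-] Va]; exists N => n Nn.
apply: le_lt_trans Va; apply: ereal_sup_ubound.
by exists n => //; exact: NV.
Qed.

Lemma limn_esup_le (u : nat -> \bar R) (a : \bar R) N :
  (forall n, (N <= n)%N -> (u n <= a)%E) -> (limn_esup u <= a)%E.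
Proof.
move=> ua; apply: (@le_trans _ _ (ereal_sup (u @` [set n | (N <= n)%N]))).
  by apply: ereal_inf_lbound; exists [set n | (N <= n)%N] => //; exists N.
by apply: ge_ereal_sup => _ [n Nn <-]; exact: ua.
Qed.

Lemma max_separated_ge1 (X : metricType R) (f : X -> X) (K : set X) n (e : R) :
  K !=set0 -> (1 <= max_separated f K n e)%E.
Proof.
move=> [v Kv]; apply: ereal_sup_ubound => /=; exists [fset v]%fset.
  split=> [w /= /fset1P -> //|w w' /=].
  by move=> /fset1P -> /fset1P ->.
by rewrite cardfs1.
Qed.

Lemma htop_on_ge0 (X : metricType R) (f : X -> X) (K : set X) :
  K !=set0 -> (0 <= htop_on f K)%E.
Proof.
move=> K0; apply: le_ereal_sup_tmp; exists (separated_growth f K 1).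
  by exists 1 => //=; exact: ltr01.
apply: limf_esup_ge0 => [|n].
  by move=> /(@filter_ex _ _ _) [].
rewrite mule_ge0// ?lee_fin ?invr_ge0// lne_ge0.
exact: max_separated_ge1.
Qed.

Lemma htop_on_le0 (X : metricType R) (f : X -> X) (K : set X) :
  K !=set0 ->
  (forall e h : R, 0 < e -> 0 < h -> exists N, forall n, (N <= n)%N ->
    (max_separated f K n e <= (expR (h * n%:R))%:E)%E) ->
  htop_on f K = 0%E.
Proof.
move=> K0 sepK; apply/eqP; rewrite eq_le htop_on_ge0// andbT.
apply: ge_ereal_sup => _ [e /= e0 <-].
apply/lee_addgt0Pr => h h0; rewrite add0e.
have [N NP] := sepK e h e0 h0.
apply: (@limn_esup_le _ _ N.+1) => n Nn.
have n0 : 0 < n%:R :> R by rewrite ltr0n; lia.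
have := NP n (ltnW Nn); have := max_separated_ge1 f n e K0.
case: max_separated => [r||]//; rewrite !lee_fin => r1 rh.
have r0 : 0 < r by exact: lt_le_trans r1.
rewrite lne_EFin// -EFinM lee_fin mulrC ler_pdivrMr//.
by rewrite -(expRK (h * n%:R)) ler_ln// posrE ?expR_gt0.
Qed.

(** A separated set of largest cardinality is spanning, since no point can be added to it; zero
    entropy bounds its cardinality. *)
Lemma zero_entropy_spanning (X : metricType R) (f : X -> X) (K : set X) :
  K !=set0 -> htop_on f K = 0%E ->
  forall e h : R, 0 < e -> 0 < h -> exists N, forall n, (N <= n)%N ->
    exists (m : nat) (g : 'I_m -> X), m%:R <= expR (h * n%:R) /\
      forall v, K v -> exists c, forall i, (i < n)%N ->
        mdist (iter i f v) (iter i f (g c)) <= e.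
Proof.
move=> K0 hK e h e0 h0.
have : (separated_growth f K e < h%:E)%E.
  apply: (@le_lt_trans _ _ 0%E); last by rewrite lte_fin.
  by rewrite -hK; apply: ereal_sup_ubound; exists e.
move=> /limn_esup_lt [N NP]; exists N.+1 => n Nn.
have n0 : 0 < n%:R :> R by rewrite ltr0n; lia.
have msh : (max_separated f K n e <= (expR (h * n%:R))%:E)%E.
  have := NP n (ltnW Nn); have := max_separated_ge1 f n e K0.
  case: max_separated => [r||]//=; last first.
    by rewrite gt0_muley ?lte_fin ?invr_gt0.
  rewrite !lee_fin => r1; have r0 : 0 < r by exact: lt_le_trans r1.
  rewrite -/(lne r%:E) lne_EFin// -EFinM lte_fin mulrC ltr_pdivrMr// => rh.
  by rewrite -(lnK r0) ler_expR ltW.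
have sepP (E : {fset X}) : [set` E] `<=` K -> Defs.separated f n e [set` E] ->
    #|` E|%:R <= expR (h * n%:R).
  move=> EK sE; rewrite -lee_fin (le_trans _ msh)//.
  by apply: ereal_sup_ubound; exists E.
pose P k := `[< exists E : {fset X}, [/\ [set` E] `<=` K,
  Defs.separated f n e [set` E] & #|` E| = k] >].
have exP : exists k, P k.
  exists 0%N; apply/asboolP; exists fset0; split=> //; by move=> ? /=.
have ubP k : P k -> (k <= Num.truncn (expR (h * n%:R)))%N.
  move=> /asboolP[E [EK sE <-]].
  by rewrite truncn_ge_nat ?expR_ge0// sepP.
have [k /asboolP[E [EK sE Ek]] maxk] := ex_maxnP exP ubP.
have [v0 Kv0] := K0.
exists #|` E|, (fun c => nth v0 (enum_fset E) c); split; first exact: sepP.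
move=> v Kv; apply: contrapT => nv.
have sep_v w : w \in E -> exists2 i, (i < n)%N &
    e < mdist (iter i f v) (iter i f w).
  move=> wE; apply: contrapT => nw; apply: nv.
  have wlt : (index w (enum_fset E) < #|` E|)%N by rewrite index_mem.
  exists (Ordinal wlt) => i iltn; rewrite /= nth_index// leNgt.
  by apply/negP => ei; apply: nw; exists i.
have vE : v \notin E.
  apply/negP => /sep_v [i _]; rewrite mdistxx ltNge => /negP; apply.
  exact: ltW.
have : P k.+1.
  apply/asboolP; exists (v |` E)%fset; split.
  - by move=> w /= /fset1UP[->//|/EK].
  - move=> w w' /= /fset1UP[->|wE] /fset1UP[->|wE']//.
    + by move=> _; exact: sep_v.
    + move=> _; have [i iltn ei] := sep_v _ wE.
      by exists i => //; rewrite metric_sym.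
    + exact: sE.
  - by rewrite cardfsU1 vE Ek.
by move=> /maxk; rewrite ltnn.
Qed.

End entropy.

(** * The orbit closure of a sequence *)

Section hull_def.
Context {R : realType}.

Definition in_hull (y w : nat -> R) : Prop :=
  (forall i, 0 <= w i <= 1) /\
  forall N (e : R), 0 < e -> exists t, forall i, (i < N)%N ->
    `|w i - y (t + i)%N| < e.

(* The orbit closure of [y] under the shift, with the metric [hull_dist]. *)
Record hull (y : nat -> R) :=
  Hull { seq_of :> nat -> R ; hullP : in_hull y seq_of }.

HB.instance Definition _ y := gen_eqMixin (hull y).
HB.instance Definition _ y := gen_choiceMixin (hull y).

Variable y : nat -> R.
Implicit Types w : hull y.

Lemma hull_inj w w' : (forall i, w i = w' i) -> w = w'.
Proof.
case: w w' => [u Pu] [v Pv] /= uv.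
have {uv} uv : u = v by apply/funext.
by subst v; congr Hull; exact: Prop_irrelevance.
Qed.

Lemma hull_ge0 w i : 0 <= w i.
Proof. by have [/(_ i)/andP[]] := hullP w. Qed.

Lemma hull_le1 w i : w i <= 1.
Proof. by have [/(_ i)/andP[]] := hullP w. Qed.

Lemma hull_dist_le1 w w' i : `|w i - w' i| <= 1.
Proof.
have := hull_ge0 w i; have := hull_le1 w i; have := hull_ge0 w' i.
by have := hull_le1 w' i; rewrite ler_norml; lra.
Qed.

(** As coordinates differ by at most 1, closeness only constrains finitely many of them: this is the
    product topology. *)
Definition hull_dist w w' : R := sup [set `|w i - w' i| / i.+1%:R | i in [set: nat]].

Lemma hull_dist_has_sup w w' :
  has_sup [set `|w i - w' i| / i.+1%:R | i in [set: nat]].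
Proof.
split; first by exists (`|w 0%N - w' 0%N| / 1%:R), 0%N.
exists 1 => _ [i _ <-]; rewrite ler_pdivrMr ?ltr0n// mul1r.
by rewrite (le_trans (hull_dist_le1 w w' i))// ler1n.
Qed.

Lemma hull_distP w w' (e : R) :
  hull_dist w w' <= e <-> forall i, `|w i - w' i| <= e * i.+1%:R.
Proof.
split=> [we i|we].
  rewrite -ler_pdivrMr ?ltr0n// (le_trans _ we)//.
  by apply: ub_le_sup; [have [] := hull_dist_has_sup w w'|exists i].
apply: ge_sup; first by have [] := hull_dist_has_sup w w'.
by move=> _ [i _ <-]; rewrite ler_pdivrMr ?ltr0n.
Qed.

Lemma hull_dist_coord w w' i : `|w i - w' i| <= hull_dist w w' * i.+1%:R.
Proof. by move: i; apply/hull_distP. Qed.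

Lemma hull_distxx w : hull_dist w w = 0.
Proof.
apply/eqP; rewrite eq_le; apply/andP; split.
  by apply/hull_distP => i; rewrite subrr normr0 mul0r.
rewrite (le_trans (normr_ge0 (w 0%N - w 0%N)))//.
by rewrite (le_trans (hull_dist_coord w w 0))// mulr1.
Qed.

Lemma hull_dist_positivity w w' : hull_dist w w' = 0 -> w = w'.
Proof.
move=> ww'; apply: hull_inj => i; apply/eqP; rewrite -subr_eq0 -normr_le0.
by rewrite (le_trans (hull_dist_coord w w' i))// ww' mul0r.
Qed.

Lemma hull_dist_sym w w' : hull_dist w w' = hull_dist w' w.
Proof. by rewrite /hull_dist; under eq_imagel do rewrite distrC. Qed.

Lemma hull_dist_triangle w' w w'' :
  hull_dist w w'' <= hull_dist w w' + hull_dist w' w''.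
Proof.
apply/hull_distP => i; rewrite (le_trans (ler_distD (w' i) _ _))//.
by rewrite mulrDl lerD// hull_dist_coord.
Qed.

End hull_def.

HB.instance Definition _ (R : realType) (y : nat -> R) :=
  @isMetric.Build R (hull y) (@hull_dist R y) (@hull_distxx R y)
    (@hull_dist_positivity R y) (@hull_dist_sym R y) (@hull_dist_triangle R y).

Section hull_theory.
Context {R : realType} (y : nat -> R).
Context (y01 : forall i, 0 <= y i <= 1).
Implicit Types w : hull y.

Lemma hull_mdistE w w' : mdist w w' = hull_dist w w'.
Proof. by []. Qed.

Lemma shift_in_hull w : in_hull y (fun i => w i.+1).
Proof.
have [w01 wy] := hullP w; split=> // N e e0.
have [t ty] := wy N.+1 e e0; exists t.+1 => i iN.
by have := ty i.+1; rewrite addnS addSn; apply.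
Qed.

Definition hull_shift w : hull y := Hull (shift_in_hull w).

Lemma iter_shiftE n w i : iter n hull_shift w i = w (n + i)%N.
Proof. by elim: n i => //= n IH i; rewrite IH addnS addSn. Qed.

Lemma in_hull_refl : in_hull y y.
Proof.
split=> // N e e0; exists 0%N => i _.
by rewrite subrr normr0.
Qed.

Definition hull_base : hull y := Hull in_hull_refl.

(** The shift is 2-Lipschitz, because [i.+2 <= 2 * i.+1]. *)
Lemma shift_continuous : continuous hull_shift.
Proof.
move=> w; apply/(cvg_mdistP _ _ (nbhs_filter w)) => e e0.
have e30 : 0 < e / 3 by rewrite divr_gt0.
apply/nbhs_ballP; exists (e / 3) => // w'.
rewrite ballEmdist /= hull_mdistE => ww'.
rewrite hull_mdistE; apply: (@le_lt_trans _ _ (2 * (e / 3))); last by lra.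
apply/hull_distP => i /=; rewrite distrC.
rewrite (le_trans (hull_dist_coord w w' i.+1))//.
apply: (@le_trans _ _ (e / 3 * i.+2%:R)).
  by rewrite ler_pM2r ?ltr0n// ltW.
rewrite (mulrC 2) -(mulrA (e / 3)) ler_pM2l// -natrM ler_nat; lia.
Qed.

(** Along an ultrafilter each coordinate converges in [[0, 1]]. The limits form a point of the hull,
    and convergence is for the metric since late coordinates weigh little. *)
Lemma hull_compact : compact [set: hull y].
Proof.
rewrite compact_ultra => F FU _.
have FF : ProperFilter F by exact: ultra_proper.
have [l lP] : {l : nat -> R & forall i (e : R), 0 < e ->
    F [set w : hull y | `|w i - l i| < e]}.
  apply: (@choice _ _ (fun i r => forall e : R, 0 < e ->
    F [set w : hull y | `|w i - r| < e])) => i.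
  have := @segment_compact R 0 1.
  move=> /(_ (fmap (fun w : hull y => w i) F) _)[].
    apply: (@filterE _ F) => w /=.
    by rewrite in_itv /= hull_ge0 hull_le1.
  move=> r [_ cr]; exists r => e e0; apply: contrapT => nF.
  have nF' := ultraC FU nF.
  have [s [/= ns]] :=
    cr [set s | ~ `|s - r| < e] _ nF' (nbhsx_ballx (r : R) _ e0).
  by rewrite /ball /= distrC.
have lN N (e : R) : 0 < e ->
    F [set w : hull y | forall i, (i < N)%N -> `|w i - l i| < e].
  move=> e0; elim: N => [|N IH]; first exact: (@filterE _ F).
  apply: (@filterS _ F) (filterI IH (lP N e e0)) => w [wN wl] i.
  by rewrite ltnS leq_eqVlt => /orP[/eqP->//|/wN].
have Pl : in_hull y l.
  split=> [i|N e e0].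
    apply/andP; split; apply/ler_addgt0Pr => e e0;
      have [w /= wl] := filter_ex (lP i e e0);
      have := hull_ge0 w i; have := hull_le1 w i;
      by move: wl; rewrite ltr_norml => /andP[]; lra.
  have e20 : 0 < e / 2 by rewrite divr_gt0.
  have [w /= wl] := filter_ex (lN N _ e20).
  have [_ /(_ N _ e20) [t ty]] := hullP w.
  exists t => i iN; rewrite (splitr e) (le_lt_trans (ler_distD (w i) _ _))//.
  by rewrite ltrD ?ty// distrC wl.
exists (Hull Pl); split=> //.
apply/(@cvg_mdistP _ _ _ F id) => e e0.
have e20 : 0 < e / 2 by rewrite divr_gt0.
pose N := Num.bound (e / 2)^-1.
apply: (@filterS _ F) (lN N _ e20) => w wl /=.
rewrite hull_mdistE; apply: (@le_lt_trans _ _ (e / 2)); last by lra.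
apply/hull_distP => i /=; have [iN|Ni] := ltnP i N.
  by rewrite (le_trans (ltW (wl _ iN)))// ler_peMr ?ler1n// ltW.
apply: le_trans (hull_dist_le1 w (Hull Pl) i) _.
rewrite mulrC -ler_pdivrMr// div1r (le_trans (ltW (archi_boundP _)))//.
  by rewrite invr_ge0 ltW.
by rewrite ler_nat -/N; lia.
Qed.

Lemma shift_is_tds : (exists t, y t != y 0%N) -> is_tds hull_shift.
Proof.
move=> [t yt]; split.
- exact: hull_compact.
- exists hull_base, (iter t hull_shift hull_base) => /(congr1 (@seq_of R y ^~ 0%N)).
  by rewrite iter_shiftE /= addn0 => y0t; move: yt; rewrite y0t eqxx.
- exact: shift_continuous.
Qed.

(** The covering words [g c] need not occur in [y], so they may be truncated and rescaled. *)
Definition words_covered (e : R) (n m : nat) :=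
  exists g : 'I_m -> nat -> R, forall t, exists c, forall i, (i < n)%N ->
    `|y (t + i)%N - g c i| <= e.

(** Points coded by the same covering word agree up to [e] on [n + l] coordinates. For shifts by
    [i < n], the remaining coordinates have index above [l] and weigh at most [e]; hence the code is
    injective on separated sets. *)
Lemma shift_max_separated (e : R) n l m : 0 < e -> 1 <= e * l.+1%:R ->
  words_covered (e / 4) (n + l) m ->
  (max_separated hull_shift [set: hull y] n e <= m%:R%:E)%E.
Proof.
move=> e0 el [g gP]; apply: ge_ereal_sup => _ [E [_ sE] <-].
rewrite lee_fin ler_nat.
have e40 : 0 < e / 4 by rewrite divr_gt0.
have [code codeP] : {code : hull y -> 'I_m & forall w i, (i < n + l)%N ->
    `|w i - g (code w) i| <= e / 2}.
  apply: (@choice _ _ (fun w c => forall i, (i < n + l)%N ->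
    `|seq_of w i - g c i| <= e / 2)) => w.
  have [_ /(_ (n + l)%N _ e40) [t ty]] := hullP w.
  have [c cP] := gP t; exists c => i il.
  rewrite (le_trans (ler_distD (y (t + i)) _ _))//.
  have := ty _ il; have := cP _ il; lra.
rewrite -(size_map code) -[leqRHS]size_enum_ord; apply: uniq_leq_size; last first.
  by move=> c _; rewrite mem_enum.
rewrite map_inj_in_uniq ?fset_uniq// => w w' wE w'E ww'.
apply: contrapT => /(sE _ _ wE w'E) [i iltn].
rewrite ltNge => /negP; apply; apply/hull_distP => j.
rewrite !iter_shiftE; have [ijnl|nlij] := ltnP (i + j) (n + l).
  rewrite (le_trans (ler_distD (g (code w) (i + j)%N) _ _))//.
  apply: (@le_trans _ _ e); last by rewrite ler_peMr ?ler1n// ltW.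
  by rewrite (splitr e) lerD ?codeP// distrC ww' codeP.
rewrite (le_trans (hull_dist_le1 _ _ _))// (le_trans el)// ler_pM2l// ler_nat; lia.
Qed.

Lemma shift_zero_entropy :
  (forall e h : R, 0 < e -> 0 < h -> exists N, forall n, (N <= n)%N ->
    exists2 m, m%:R <= expR (h * n%:R) & words_covered e n m) ->
  htop hull_shift = 0%E.
Proof.
move=> yh; apply: htop_on_le0; first by exists hull_base.
move=> e h e0 h0.
have e40 : 0 < e / 4 by rewrite divr_gt0.
(* The rate is halved because words of length [n + l <= 2 * n] are counted. *)
have h20 : 0 < h / 2 by rewrite divr_gt0.
have [N NP] := yh _ _ e40 h20.
pose l := Num.bound e^-1.
have el : 1 <= e * l.+1%:R.
  rewrite mulrC -ler_pdivrMr// div1r.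
  by rewrite (le_trans (ltW (archi_boundP _))) ?invr_ge0 ?(ltW e0)// ler_nat -/l.
exists (maxn N l) => n; rewrite geq_max => /andP[Nn ln].
have [|m mh my] := NP (n + l)%N; first by rewrite (leq_trans Nn)// leq_addr.
apply: le_trans (shift_max_separated e0 el my) _.
rewrite lee_fin (le_trans mh)// ler_expR -mulrA ler_pM2l// mulrC.
by rewrite ler_pdivrMr// -natrM ler_nat; lia.
Qed.

End hull_theory.

(** * Covering sets of words *)

Section cover.
Context {R : realType}.
Implicit Types (S : set (nat -> R)) (n : nat) (e B : R).

Definition covered n e S B :=
  exists (m : nat) (g : 'I_m -> nat -> R), m%:R <= B /\
    forall u, S u -> exists c, forall i, (i < n)%N -> `|u i - g c i| <= e.

Lemma covered_sub n e S S' B B' : (forall u, S u -> exists2 u', S' u' &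
    forall i, (i < n)%N -> u i = u' i) -> B' <= B ->
  covered n e S' B' -> covered n e S B.
Proof.
move=> SS' BB' [m [g [mB gP]]]; exists m, g; split; first exact: le_trans BB'.
move=> u /SS' [u' /gP [c cP] uu']; exists c => i iltn.
by rewrite uu'// cP.
Qed.

Lemma covered0 n e B : 0 <= B -> covered n e set0 B.
Proof. by move=> B0; exists 0%N, (fun _ _ => 0); split=> // u []. Qed.

Lemma covered1 n e u : 0 <= e -> covered n e [set u] 1.
Proof.
move=> e0; exists 1%N, (fun _ => u); split=> // _ ->; exists ord0 => i _.
by rewrite subrr normr0.
Qed.

Lemma coveredU n e S S' B B' : covered n e S B -> covered n e S' B' ->
  covered n e (S `|` S') (B + B').
Proof.
move=> [m [g [mB gP]]] [m' [g' [mB' gP']]].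
exists (m + m')%N, (fun c =>
  match fintype.split c with inl c => g c | inr c => g' c end).
split; first by rewrite natrD lerD.
move=> u [/gP|/gP'] [c cP].
  exists (lshift _ c) => i /cP; case: splitP => j /= jE.
    by rewrite (_ : j = c)//; exact: val_inj.
  by have := ltn_ord c; lia.
exists (rshift _ c) => i /cP; case: splitP => j /= jE.
  by have := ltn_ord j; lia.
by rewrite (_ : j = c)//; apply: val_inj => /=; lia.
Qed.

Lemma covered_bigU n e (q : nat) (S : nat -> set (nat -> R)) B :
  (forall i, (i < q)%N -> covered n e (S i) B) ->
  covered n e [set u | exists2 i, (i < q)%N & S i u] (q%:R * B).
Proof.
elim: q => [|q IH] SB.
  by apply: covered_sub (covered0 n e (lexx 0)) => [u [] //|]; rewrite mul0r.
apply: covered_sub (coveredU (IH _) (SB q _)) => //.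
- move=> u [i]; rewrite ltnS leq_eqVlt => /orP[/eqP->|iq] Su; exists u => //.
    by right.
  by left; exists i.
- by rewrite -natr1 mulrDl mul1r.
- by move=> i iq; apply: SB; rewrite ltnW.
Qed.

Definition cutoff (a b : nat) (u : nat -> R) (i : nat) : R :=
  if (a <= i < b)%N then u i else 0.

Lemma covered_cutoff n e S B : 0 <= e -> covered n e S B ->
  covered n e [set v | exists a b u,
    [/\ (a <= n)%N, (b <= n)%N, S u & v = cutoff a b u]]
    (n.+1%:R * (n.+1%:R * B)).
Proof.
move=> e0 SB.
apply: (covered_sub (S' := [set v | exists2 a, (a < n.+1)%N &
  [set v | exists2 b, (b < n.+1)%N & [set cutoff a b u | u in S] v] v])) => //.
  move=> _ [a [b [u [an bn Su ->]]]]; exists (cutoff a b u) => //.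
  by exists a => //; exists b => //; exists u.
apply: covered_bigU => a _; apply: covered_bigU => b _.
have [m [g [mB gP]]] := SB; exists m, (fun c => cutoff a b (g c)); split=> //.
move=> _ [u /gP [c cP] <-]; exists c => i iltn; rewrite /cutoff.
by case: ifP => _; [exact: cP|rewrite subrr normr0].
Qed.

(** The scalar is rounded down to one of the [K.+1] multiples of [1 / K] in [[0, 1]]; this costs one
    [e] and the word costs the other. *)
Lemma covered_scale n e S B (K : nat) : (0 < K)%N -> K%:R^-1 <= e ->
  (forall u i, S u -> 0 <= u i <= 1) -> covered n e S B ->
  covered n (e + e) [set v | exists c u,
    [/\ 0 <= c <= 1, S u & v = (fun i => c * u i)]] (K.+1%:R * B).
Proof.
move=> K0 Ke S01 [m [g [mB gP]]].
have K0' : 0 < K%:R :> R by rewrite ltr0n.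
apply: (covered_sub (S' := [set v | exists2 j, (j < K.+1)%N &
  [set v | exists c u, [/\ S u, `|c - j%:R / K%:R| <= e &
    v = (fun i => c * u i)]] v])) => //.
  move=> _ [c [u [/andP[c0 c1] Su ->]]]; exists (fun i => c * u i) => //.
  have cK0 : 0 <= c * K%:R by rewrite mulr_ge0// ltW.
  exists (Num.truncn (c * K%:R)).
    rewrite ltnS -(ler_nat R) (@le_trans _ _ (c * K%:R)) ?truncn_le//.
    by rewrite ler_piMl// ltW.
  exists c, u; split=> //; rewrite (le_trans _ Ke)//.
  have /andP[t1 t2] := truncn_itv cK0.
  rewrite ger0_norm; last by rewrite subr_ge0 ler_pdivrMr.
  by rewrite lerBlDr -{1}(div1r K%:R) -mulrDl ler_pdivlMr// nat1r ltW.
apply: covered_bigU => j jK.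
exists m, (fun c i => j%:R / K%:R * g c i); split=> //.
have jK0 : 0 <= j%:R / K%:R :> R by rewrite divr_ge0.
have jK1 : j%:R / K%:R <= 1 :> R by rewrite ler_pdivrMr// mul1r ler_nat.
move=> _ [c [u [Su cj ->]]]; have [d dP] := gP _ Su; exists d => i iltn.
have /andP[u0 u1] := S01 u i Su.
have -> : c * u i - j%:R / K%:R * g d i =
  (c - j%:R / K%:R) * u i + j%:R / K%:R * (u i - g d i) by ring.
rewrite (le_trans (ler_normD _ _))// lerD// normrM.
  by rewrite (le_trans _ cj)// ler_piMr// ger0_norm.
by rewrite (le_trans _ (dP _ iltn))// ger0_norm// ler_piMl.
Qed.

End cover.

(** Degree 4 is that of the later count of words: two for the base words, two for the endpoints of
    the cutoffs. The fifth power of [expR (h / 5 * n)] dominates it. *)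
Lemma poly_le_exp (R : realType) (C h : R) : 0 <= C -> 0 < h ->
  exists N, forall n, (N <= n)%N -> C * n.+1%:R ^+ 4 <= expR (h * n%:R).
Proof.
move=> C0 h0.
pose D := C * 2 ^+ 4 / (h / 5) ^+ 5.
have h50 : 0 < h / 5 by rewrite divr_gt0.
have D0 : 0 <= D.
  apply: divr_ge0; last by apply: exprn_ge0; exact: ltW.
  by apply: mulr_ge0 => //; exact: exprn_ge0.
exists (maxn 1 (Num.bound D)) => n; rewrite geq_max => /andP[n1 Dn].
have nD : D <= n%:R.
  by rewrite (le_trans (ltW (archi_boundP D0)))// ler_nat.
have -> : h * n%:R = 5%:R * (h / 5 * n%:R) by field.
rewrite expRM_natl.
apply: (@le_trans _ _ ((h / 5 * n%:R) ^+ 5)); last first.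
  have hn0 : 0 <= h / 5 * n%:R by rewrite mulr_ge0// ltW.
  rewrite lerXn2r ?nnegrE ?expR_ge0//.
  by rewrite (le_trans _ (expR_ge1Dx _))// lerDr.
apply: (@le_trans _ _ (C * (2 * n%:R) ^+ 4)).
  rewrite ler_wpM2l// lerXn2r ?nnegrE ?mulr_ge0// -natrM ler_nat; lia.
have H50 : 0 < (h / 5) ^+ 5 by exact: exprn_gt0.
rewrite [leLHS](_ : _ = C * 2 ^+ 4 * n%:R ^+ 4); last by ring.
rewrite [leRHS](_ : _ = n%:R * (h / 5) ^+ 5 * n%:R ^+ 4); last by ring.
by rewrite ler_wpM2r ?exprn_ge0// -ler_pdivrMr.
Qed.

(** * A sequence made of copies of its own words *)

Section copies.
Context {R : realType} {X : metricType R} (f : X -> X) (z : X).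
(** For type [k], [rho k] is the radius of the weight and [M k] the spacing of the copies, of length
    [k]; [tau t] is the type of the window containing [t], if any. *)
Context (rho : nat -> R) (M : nat -> nat) (tau : nat -> option nat).
Context (rho0 : forall k, 0 < rho k) (Mk : forall k, (2 * k + 2 <= M k)%N).
Context (tauM : forall t k, tau t = Some k -> (M k <= t)%N).

(** A Lipschitz substitute for the indicator of a ball: nearby orbits give nearby weights. *)
Definition tent k (v : X) : R := Num.max 0 (1 - mdist v z / rho k).

Lemma tent_ge0 k v : 0 <= tent k v.
Proof. by rewrite /tent le_max lexx. Qed.

Lemma tent_le1 k v : tent k v <= 1.
Proof.
by rewrite /tent ge_max ler01 lerBlDr lerDl divr_ge0// ?mdist_ge0// ltW.
Qed.

Lemma tent_neq0 k v : tent k v != 0 -> mdist v z < rho k.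
Proof.
rewrite /tent; apply: contraNT; rewrite -leNgt => rv; apply/eqP/max_idPl.
by rewrite subr_le0 ler_pdivlMr ?mul1r.
Qed.

Lemma tent_ge k v : 1 - mdist v z / rho k <= tent k v.
Proof. by rewrite /tent le_max lexx orbT. Qed.

Lemma tent_lip k v w : `|tent k v - tent k w| <= mdist v w / rho k.
Proof.
have aux a b : tent k a <= tent k b + mdist a b / rho k.
  rewrite {1}/tent ge_max addr_ge0 ?tent_ge0 ?divr_ge0 ?mdist_ge0 ?(ltW (rho0 k))//=.
  have := tent_ge k b.
  have : mdist b z / rho k <= mdist a b / rho k + mdist a z / rho k.
    by rewrite -mulrDl ler_pM2r ?invr_gt0// (metric_sym a b) metric_triangle.
  lra.
have := aux v w; have := aux w v; rewrite (metric_sym w v) ler_norml => *.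
by apply/andP; split; lra.
Qed.

(** The argument [n] is fuel: at times of type [k], [t %% M k < M k <= t] by [tauM], so fuel [t]
    suffices. *)
Fixpoint copies_rec (n t : nat) : R :=
  if t == 0%N then 1 else
  if n isn't n'.+1 then 0 else
  if tau t isn't Some k then 0 else
  if (t %% M k < k)%N
  then tent k (iter (M k * (t %/ M k)) f z) * copies_rec n' (t %% M k) else 0.

(* At the times [t] of type [k], this sequence consists of copies of its own
   word of length [k], placed at multiples of [M k] and weighted by the
   proximity to [z] of the orbit of [z]. *)
Definition copies t := copies_rec t t.

Lemma M_gt0 k : (0 < M k)%N.
Proof. by have := Mk k; lia. Qed.

Lemma copies_recE n t : (t <= n)%N -> copies_rec n t = copies t.
Proof.
rewrite /copies; elim/ltn_ind: t n => t IH [|n] tn.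
  by have -> : t = 0%N by lia.
case: t tn IH => [//|t] tn IH /=.
case tauE : (tau t.+1) => [k|//]; case: ifP => // tk.
have tM : (t.+1 %% M k < t.+1)%N.
  by rewrite (leq_trans _ (tauM tauE))// ltn_mod M_gt0.
by rewrite IH// ?[in RHS]IH//; lia.
Qed.

Lemma copies0 : copies 0 = 1. Proof. by []. Qed.

Lemma copiesE t : (0 < t)%N -> copies t =
  if tau t isn't Some k then 0 else
  if (t %% M k < k)%N
  then tent k (iter (M k * (t %/ M k)) f z) * copies (t %% M k) else 0.
Proof.
case: t => // t _; rewrite {1}/copies /=.
case tauE : (tau t.+1) => [k|//]; case: ifP => // tk.
rewrite copies_recE//.
have : (t.+1 %% M k < t.+1)%N.
  by rewrite (leq_trans _ (tauM tauE))// ltn_mod M_gt0.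
lia.
Qed.

Lemma copies01 t : 0 <= copies t <= 1.
Proof.
elim/ltn_ind: t => t IH; case: (posnP t) => [->|t0].
  by rewrite copies0 ler01 lexx.
rewrite copiesE//; case tauE : (tau t) => [k|]; last by rewrite lexx ler01.
case: ifP => tk; last by rewrite lexx ler01.
have /IH/andP[c0 c1] : (t %% M k < t)%N.
  by rewrite (leq_trans _ (tauM tauE))// ltn_mod M_gt0.
rewrite mulr_ge0 ?tent_ge0//=.
by rewrite mulr_ile1 ?tent_ge0 ?tent_le1.
Qed.

(** Write [t = M k * q + a]. A nonzero value puts [f^(M k * q) z] within [rho k] of [z] and, by
    induction on [t], [f^a z] within [r]; the choice of [rho k] concludes. *)
Lemma copies_neq0_close (r : R) : 0 < r ->
  (forall k a, (a < k)%N -> mdist (iter a f z) z < r ->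
    forall v, mdist v z < rho k -> mdist (iter a f v) z < r) ->
  forall t, copies t != 0 -> mdist (iter t f z) z < r.
Proof.
move=> r0 rhoP; elim/ltn_ind => t IH; case: (posnP t) => [->|t0].
  by rewrite /= mdistxx.
rewrite copiesE//; case tauE : (tau t) => [k|]; last by rewrite eqxx.
case: ifP => tk; last by rewrite eqxx.
rewrite mulf_eq0 negb_or => /andP[/tent_neq0 bz cn0].
rewrite [t in iter t](divn_eq t (M k)) mulnC addnC iterD.
apply: (rhoP k) => //; apply: IH => //.
by rewrite (leq_trans _ (tauM tauE))// ltn_mod M_gt0.
Qed.

Lemma copies_tau t : (0 < t)%N -> copies t != 0 -> exists k, tau t = Some k.
Proof.
by move=> t0; rewrite copiesE//; case: tau => [k|]; [exists k|rewrite eqxx].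
Qed.

(** The word read from time [M k * q + c] inside a window of type [k], when [v] is
    [f^(M k * q) z]. *)
Definition typed_word k c (v : X) (i : nat) : R :=
  if ((c + i) %% M k < k)%N
  then tent k (iter (M k * ((c + i) %/ M k)) f v) * copies ((c + i) %% M k) else 0.

Context (tau_window : forall n t, (n < t)%N -> exists k a b,
  [/\ (a <= n)%N, (b <= n)%N & forall i, (i < n)%N ->
    tau (t + i)%N = if (a <= i < b)%N then Some k else None]).

(** Early words, delayed beginnings of the sequence, and typed words: every word of length [n] is a
    scaled cutoff of one of these. *)
Definition base_words n : set (nat -> R) :=
  [set u | exists2 t, (t < n.+1)%N & u = (fun i => copies (t + i))] `|`
  [set u | exists2 c, (c < n.+1)%N &
    u = (fun i => if (i < c)%N then 0 else copies (i - c))] `|`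
  [set u | exists2 k, (k < (2 * n).+1)%N & [set u | exists2 c, (c < 2 * n)%N &
    [set u | (M k <= 2 * n)%N /\
      exists2 q, True & u = typed_word k c (iter q f z)] u] u].

(* If [M k <= 2 * n] for the type [k] of the window visible from [t], the word is
   typed. Otherwise it meets a single copy, hence it is a weighted piece either
   of the beginning of the sequence or of a word at a time smaller than [t]. *)
Lemma copies_word n t : exists c a b w, [/\ 0 <= c <= 1, (a <= n)%N, (b <= n)%N,
  base_words n w & forall i, (i < n)%N -> copies (t + i) = c * cutoff a b w i].
Proof.
have zero : exists w, base_words n w.
  by exists (fun i => copies (0 + i)); left; left; exists 0%N.
have Z (u : nat -> R) : (forall i, (i < n)%N -> u i = 0) ->
  exists c a b w, [/\ 0 <= c <= 1, (a <= n)%N, (b <= n)%N,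
  base_words n w & forall i, (i < n)%N -> u i = c * cutoff a b w i].
  move=> u0; have [w bw] := zero; exists 0, 0%N, 0%N, w; split=> //.
    by rewrite lexx ler01.
  by move=> i iltn; rewrite u0// mul0r.
elim/ltn_ind: t => t IH.
have [tn|nt] := leqP t n.
  exists 1, 0%N, n, (fun i => copies (t + i)); split=> //.
    by rewrite ler01 lexx.
    by left; left; exists t.
  by move=> i iltn; rewrite mul1r /cutoff /= iltn.
have [k [a [b [an bn tauE]]]] := tau_window nt.
have M0 := M_gt0 k; have kM := Mk k.
pose c := (t %% M k)%N; pose q := (t %/ M k)%N.
have tE : t = (M k * q + c)%N by rewrite /c /q mulnC -divn_eq.
have cM : (c < M k)%N by rewrite ltn_mod.
have tmod i : ((t + i) %% M k = (c + i) %% M k)%N by rewrite tE -addnA mulnC modnMDl.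
have tdiv i : ((t + i) %/ M k = q + (c + i) %/ M k)%N.
  by rewrite tE -addnA mulnC divnMDl.
have cE i : (i < n)%N -> copies (t + i) =
    if (a <= i < b)%N then typed_word k c (iter (M k * q) f z) i else 0.
  move=> iltn; rewrite copiesE; last by lia.
  rewrite tauE//; case: ifP => // _; rewrite /typed_word tmod tdiv.
  by case: ifP => // _; rewrite mulnDr addnC iterD.
have [M2n|M2n] := leqP (M k) (2 * n).
  exists 1, a, b, (typed_word k c (iter (M k * q) f z)); split=> //.
  - by rewrite ler01 lexx.
  - right; exists k; first by rewrite ltnS; lia.
    by exists c; [exact: leq_trans cM _|split=> //; exists (M k * q)%N].
  - by move=> i iltn; rewrite mul1r cE.
have [ck|kc] := ltnP c k.
  have small i : (i < n)%N -> (c + i < M k)%N by lia.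
  (* The word starts inside a copy and stops before the next one. If [q = 0], its times are below
     [M k], so none has type [k]; otherwise [c < t] and the induction hypothesis applies to [c]. *)
  have [q0|q0] := posnP q.
    apply: Z => i iltn; rewrite copiesE; last by lia.
    case tauE' : (tau _) => [k'|//]; have := tauM tauE'.
    move: tauE'; rewrite tauE//; case: ifP => // _ [<-].
    by have := small i iltn; rewrite tE q0; lia.
  have [|c' [a' [b' [w [/andP[c0 c1] a'n b'n bw wE]]]]] := IH c; first by nia.
  exists (tent k (iter (M k * q) f z) * c'), (maxn a a'),
    (minn (minn b b') (k - c)), w; split=> //.
  - by rewrite mulr_ge0 ?tent_ge0//= mulr_ile1 ?tent_ge0 ?tent_le1.
  - by rewrite geq_max an.
  - by lia.
  move=> i iltn; rewrite cE// /typed_word divn_small ?modn_small ?small// muln0 /=.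
  rewrite wE// /cutoff.
  case: (boolP (a <= i < b)%N) => ab; case: (boolP (a' <= i < b')%N) => ab';
    case: (ltnP (c + i) k) => cik; case: ifP => m; rewrite ?mulr0 ?mulrA//; lia.
(* Here [t] is past the copy placed at [M k * q]; only the next copy, at offset [M k - c], can be
   met. *)
have [cn|nc] := leqP (M k - c) n; last first.
  apply: Z => i iltn; rewrite cE// /typed_word modn_small; last by lia.
  by rewrite (_ : (c + i < k)%N = false); [case: ifP|lia].
exists (tent k (iter (M k * q.+1) f z)), (maxn a (M k - c)),
  (minn b (M k - c + k)),
  (fun i => if (i < M k - c)%N then 0 else copies (i - (M k - c))).
split=> //.
- by rewrite tent_ge0 tent_le1.
- by rewrite geq_max an.
- by lia.
- by left; right; exists (M k - c)%N.
move=> i iltn; rewrite cE// /typed_word /cutoff.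
have [iM|Mi] := ltnP i (M k - c).
  rewrite modn_small; last by lia.
  rewrite (_ : (c + i < k)%N = false); last by lia.
  rewrite (_ : (maxn a (M k - c) <= i)%N = false) /=; last by lia.
  by rewrite mulr0; case: ifP.
have -> : (c + i = 1 * M k + (i - (M k - c)))%N by lia.
rewrite modnMDl divnMDl// modn_small; last by lia.
rewrite divn_small; last by lia.
rewrite addn0 muln1 -iterD -[X in iter X](_ : M k * q.+1 = _)%N; last by lia.
case: (boolP (a <= i < b)%N) => ab; case: ltnP => cik; case: ifP => m;
  rewrite ?mulr0//; lia.
Qed.

(** * Counting the words of the sequence of copies *)

Definition spanned n (e B : R) := exists (m : nat) (g : 'I_m -> X), m%:R <= B /\
  forall q, exists c, forall i, (i < n)%N ->
    mdist (iter i f (iter q f z)) (iter i f (g c)) <= e.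

Lemma spannedS n (e e' B B' : R) : e <= e' -> B <= B' ->
  spanned n e B -> spanned n e' B'.
Proof.
move=> ee' BB' [m [g [mB gP]]]; exists m, g; split; first exact: le_trans BB'.
by move=> q; have [c cP] := gP q; exists c => i /cP /le_trans; exact.
Qed.

(** The weights are read at times at most [c + i < 3 * n], and precision [e * rho k] suffices since
    [tent k] has Lipschitz constant [1 / rho k]. *)
Lemma covered_typed_words n k c (e B : R) : (c < 2 * n)%N ->
  spanned (3 * n) (e * rho k) B ->
  covered n e [set u | exists2 q, True & u = typed_word k c (iter q f z)] B.
Proof.
move=> c2n [m [g [mB gP]]]; exists m, (fun d => typed_word k c (g d)); split=> //.
move=> _ [q _ ->]; have [d dP] := gP q; exists d => i iltn; rewrite /typed_word.
have i3n : (M k * ((c + i) %/ M k) < 3 * n)%N.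
  by rewrite mulnC (leq_ltn_trans (leq_divM _ _))//; lia.
have := dP _ i3n; rewrite -ler_pdivrMr// => de.
case: ifP => _; last first.
  by rewrite subrr normr0 (le_trans _ de)// divr_ge0 ?mdist_ge0// ltW.
have /andP[c0 c1] := copies01 ((c + i) %% M k).
rewrite -mulrBl normrM (ger0_norm c0) (le_trans _ de)//.
by rewrite (le_trans _ (tent_lip _ _ _))// ler_piMr.
Qed.

Context (spanned_exp : forall e h : R, 0 < e -> 0 < h ->
  exists N, forall n, (N <= n)%N -> spanned n e (expR (h * n%:R))).
Context (spanned_M : forall k n, (M k <= n)%N ->
  spanned n (k.+1%:R^-1 * rho k) (expR (k.+1%:R^-1 * n%:R))).

(** Finitely many types are treated by [spanned_exp]. For the others [1 / k.+1] is below [e] and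
    [h], and [spanned_M] needs no threshold beyond [M k]. *)
Lemma spanned_uniform (e h : R) : 0 < e -> 0 < h ->
  exists N, forall n, (N <= n)%N -> forall k, (M k <= 2 * n)%N ->
    spanned (3 * n) (e * rho k) (expR (h * (3 * n)%:R)).
Proof.
move=> e0 h0.
have eh0 : 0 < Num.min e h by rewrite lt_min e0.
pose K := Num.bound (Num.min e h)^-1.
have small : exists N, forall n, (N <= n)%N -> forall k, (k < K)%N ->
    spanned n (e * rho k) (expR (h * n%:R)).
  elim: K => [|K [N NP]]; first by exists 0%N.
  have [N' N'P] := spanned_exp (mulr_gt0 e0 (rho0 K)) h0.
  exists (maxn N N') => n; rewrite geq_max => /andP[Nn N'n] k.
  by rewrite ltnS leq_eqVlt => /orP[/eqP->|]; [exact: N'P|exact: NP].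
have [N NP] := small; exists N => n Nn k kn.
have [kK|Kk] := ltnP k K; first by apply: NP => //; lia.
have : k.+1%:R^-1 <= Num.min e h.
  rewrite invf_ple ?posrE ?ltr0n//.
  rewrite (le_trans (ltW (archi_boundP _))) ?invr_ge0 ?(ltW eh0)//.
  by rewrite ler_nat; exact: (leqW Kk).
rewrite le_min => /andP[ke kh].
have Mn : (M k <= 3 * n)%N by lia.
apply: spannedS (spanned_M Mn).
  by rewrite ler_wpM2r// ltW.
by rewrite ler_expR ler_wpM2r.
Qed.

(** There are [n.+1] words of each of the first two kinds, and
    [(2 * n).+1 * (2 * n) <= 4 * n.+1 ^ 2] pairs [(k, c)]. *)
Lemma base_words_covered n (e E : R) : 0 <= e -> 1 <= E ->
  (forall k, (M k <= 2 * n)%N -> spanned (3 * n) (e * rho k) E) ->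
  covered n e (base_words n) (6 * n.+1%:R ^+ 2 * E).
Proof.
move=> e0 E1 spE.
have E0 : 0 <= E by exact: le_trans E1.
have n1 : 1 <= n.+1%:R :> R by rewrite ler1n.
have c1 (u : nat -> nat -> R) :
    covered n e [set v | exists2 t, (t < n.+1)%N & v = u t] (n.+1%:R * 1).
  by apply: covered_bigU => t _; apply: covered1.
have typed : covered n e [set u | exists2 k, (k < (2 * n).+1)%N &
    [set u | exists2 c, (c < 2 * n)%N &
    [set u | (M k <= 2 * n)%N /\
      exists2 q, True & u = typed_word k c (iter q f z)] u] u]
    ((2 * n).+1%:R * ((2 * n)%:R * E)).
  apply: covered_bigU => k _; apply: covered_bigU => c c2n.
  have [M2n|M2n] := leqP (M k) (2 * n).
    apply: covered_sub (covered_typed_words c2n (spE k M2n)) => // u [_ ?].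
    by exists u.
  apply: covered_sub (covered0 n e (lexx 0)) => // u []//.
have c2 := coveredU (c1 (fun t i => copies (t + i)))
  (c1 (fun c i => if (i < c)%N then 0 else copies (i - c))).
apply: covered_sub (coveredU c2 typed) => [u bu|]; first by exists u.
set N := n.+1%:R; have nN : (2 * n).+1%:R * (2 * n)%:R <= 4 * N ^+ 2.
  by rewrite /N -natrM -natrX -natrM ler_nat expnS expn1; nia.
have : N <= N ^+ 2 * E by rewrite expr2 -mulrA ler_peMr ?mulr_ege1// ltW// ltr0n.
have := ler_wpM2r E0 nN; rewrite -!mulrA => ? ?; lra.
Qed.

Lemma base_words01 n u i : base_words n u -> 0 <= u i <= 1.
Proof.
have z01 : 0 <= (0 : R) <= 1 by rewrite lexx ler01.
move=> [[[t _ ->]|[c _ ->]]|[k _ [c _ [_ [q _ ->]]]]].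
- exact: copies01.
- by case: ifP => _ //; exact: copies01.
- rewrite /typed_word; case: ifP => // _.
  have /andP[c0 c1] := copies01 ((c + i) %% M k).
  by rewrite mulr_ge0 ?tent_ge0//= mulr_ile1 ?tent_ge0 ?tent_le1.
Qed.

Lemma copies_words_covered (e h : R) : 0 < e -> 0 < h ->
  exists N, forall n, (N <= n)%N ->
    exists2 m, m%:R <= expR (h * n%:R) & words_covered copies e n m.
Proof.
move=> e0 h0.
have e20 : 0 < e / 2 by rewrite divr_gt0.
(* Orbit segments of length [3 * n] at rate [h / 6] use half of the exponent; polynomial factors use
   the other half. *)
have h60 : 0 < h / 6 by rewrite divr_gt0.
have h20 : 0 < h / 2 by rewrite divr_gt0.
have [N1 N1P] := spanned_uniform e20 h60.
pose K := (Num.bound (e / 2)^-1).+1.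
have Ke : K%:R^-1 <= e / 2.
  rewrite invf_ple ?posrE ?ltr0n//.
  rewrite (le_trans (ltW (archi_boundP _))) ?invr_ge0 ?(ltW e20)//.
  by rewrite ler_nat leqnSn.
have [N2 N2P] := poly_le_exp (mulr_ge0 (ler0n R K.+1) (ler0n R 6)) h20.
exists (maxn N1 N2) => n; rewrite geq_max => /andP[N1n N2n].
set E := expR (h / 6 * (3 * n)%:R).
have E1 : 1 <= E by rewrite -expR0 ler_expR mulr_ge0// ltW.
have cov := base_words_covered (ltW e20) E1 (N1P n N1n).
have cov2 := covered_cutoff (ltW e20) cov.
have /(_ K) := covered_scale _ _ _ cov2.
move=> /(_ isT Ke) [|m [g [mB gP]]].
  move=> _ i [a [b [u [_ _ bu ->]]]]; rewrite /cutoff; case: ifP => _.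
    exact: base_words01 bu.
  by rewrite lexx ler01.
exists m.
  apply: le_trans mB _.
  have -> : h * n%:R = h / 2 * n%:R + h / 6 * (3 * n)%:R by rewrite natrM; field.
  rewrite expRD -/E.
  apply: (@le_trans _ _ (K.+1%:R * 6 * n.+1%:R ^+ 4 * E)).
    by rewrite le_eqVlt; apply/orP; left; apply/eqP; ring.
  by rewrite ler_wpM2r ?N2P// (le_trans _ E1).
exists g => t.
have [c [a [b [w [c01 an bn bw wE]]]]] := copies_word n t.
have [|d dP] := gP (fun i => c * cutoff a b w i).
  by exists c, (cutoff a b w); split=> //; exists a, b, w.
exists d => i iltn; rewrite wE// (le_trans (dP i iltn))//.
by rewrite -splitr.
Qed.

End copies.

(** * Thick windows of prescribed types *)

Lemma piecewise_syndeticS (A S T : set nat) :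
  syndetic S -> thick T -> S `&` T `<=` A -> piecewise_syndetic A.
Proof.
(* Adding [A] to both sets makes their intersection equal to [A]. *)
move=> [L L0 SL] tT STA; exists (S `|` A), (T `|` A); split.
- by exists L => // i; have [j ij Sj] := SL i; exists j => //; left.
- by move=> n; have [m mT] := tT n; exists m => i /mT; left.
- by rewrite -setUIl; apply/esym/setUidPr.
Qed.

(* Disjoint windows of growing length, at positions growing so fast that at
   most one of them is visible from [t] at a distance less than [t]. *)
Lemma exists_windows (M : nat -> nat) (P : nat -> Prop) :
  (forall N l, exists2 s, (N <= s)%N & forall i, (i < l)%N -> P (s + i)%N) ->
  exists tau : nat -> option nat, [/\
    forall t k, tau t = Some k -> (M k <= t)%N /\ P t,
    forall k, thick [set t | tau t = Some k] &
    forall n t, (n < t)%N -> exists k a b,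
      [/\ (a <= n)%N, (b <= n)%N & forall i, (i < n)%N ->
        tau (t + i)%N = if (a <= i < b)%N then Some k else None]].
Proof.
(* The 2-adic valuation takes each value infinitely often, so each type gets arbitrarily long
   windows. *)
move=> Prun; pose kind := logn 2.
have [start startP] : {start : nat * nat -> nat & forall jE,
    (2 * jE.2 + M (kind jE.1) <= start jE)%N /\
    forall i, (i < jE.1)%N -> P (start jE + i)%N}.
  apply: (@choice _ _ (fun jE s => (2 * jE.2 + M (kind jE.1) <= s)%N /\
    forall i, (i < jE.1)%N -> P (s + i)%N)) => jE.
  by have [s s1 s2] := Prun (2 * jE.2 + M (kind jE.1))%N jE.1; exists s.
pose fix e j := if j is j'.+1 then (start (j', e j') + j')%N else 0%N.
pose s j := start (j, e j).
have eS j : e j.+1 = (s j + j)%N by [].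
have sE j : (2 * e j + M (kind j) <= s j)%N by have [] := startP (j, e j).
have sP j i : (s j <= i < e j.+1)%N -> P i.
  move=> /andP[si ie]; rewrite -(subnKC si).
  have [_] := startP (j, e j); apply => /=; rewrite eS in ie; lia.
have e_mono i j : (i <= j)%N -> (e i <= e j)%N.
  elim: j => [|j IH]; first by rewrite leqn0 => /eqP->.
  rewrite leq_eqVlt => /orP[/eqP->//|]; rewrite ltnS => /IH /leq_trans; apply.
  by rewrite eS; have := sE j; lia.
have [tau tauP] : {tau : nat -> option nat & forall t,
    (exists2 j, (s j <= t < e j.+1)%N & tau t = Some (kind j)) \/
    ((forall j, ~~ (s j <= t < e j.+1)%N) /\ tau t = None)}.
  apply: (@choice _ _ (fun t o =>
    (exists2 j, (s j <= t < e j.+1)%N & o = Some (kind j)) \/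
    ((forall j, ~~ (s j <= t < e j.+1)%N) /\ o = None))) => t.
  have [[j jt]|nj] := pselect (exists j, (s j <= t < e j.+1)%N).
    by exists (Some (kind j)); left; exists j.
  exists None; right; split=> // j; apply/negP => jt; apply: nj; by exists j.
(* Meeting window [j] gives [t < e j'], hence [t + i' < 2 * t < 2 * e j' <= s j']. *)
have far j j' n t i i' : (j < j')%N -> (n < t)%N -> (i < n)%N -> (i' < n)%N ->
    (s j <= t + i < e j.+1)%N -> (s j' <= t + i' < e j'.+1)%N -> False.
  by move=> jj'; have := e_mono _ _ jj'; have := sE j'; lia.
have uniq_window j j' n t i i' : (n < t)%N -> (i < n)%N -> (i' < n)%N ->
    (s j <= t + i < e j.+1)%N -> (s j' <= t + i' < e j'.+1)%N -> j = j'.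
  move=> nt iltn i'n ji j'i'.
  have [jj'|jj'|//] := ltngtP j j'.
    by case: (far j j' n t i i').
  by case: (far j' j n t i' i).
have tauE j t : (s j <= t < e j.+1)%N -> tau t = Some (kind j).
  move=> jt; case: (tauP t) => [[j' j't ->]|[/(_ j)]]; last by rewrite jt.
  congr (Some (kind _)).
  have [jj'|jj'|//] := ltngtP j' j.
    by have := e_mono _ _ jj'; have := sE j; lia.
  by have := e_mono _ _ jj'; have := sE j'; lia.
exists tau; split.
- move=> t k; case: (tauP t) => [[j jt ->] [<-]|[_ ->]//].
  by split; [have := sE j; lia|exact: sP jt].
- move=> k n; pose j := (2 ^ k * (2 * n + 1))%N.
  have kj : kind j = k.
    rewrite /kind /j lognM ?expn_gt0 ?addn1// pfactorK// lognE /= dvdn2.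
    by rewrite /= mul2n odd_double addn0.
  have nj : (n <= j)%N.
    by rewrite /j; have := expn_gt0 2 k; nia.
  exists (s j) => i iltn /=; rewrite -kj; apply: tauE; rewrite eS; lia.
- move=> n t nt.
  have [[i0 [i0n [j ji0]]]|nw] := pselect (exists i0, (i0 < n)%N /\
      exists j, (s j <= t + i0 < e j.+1)%N).
    exists (kind j), (s j - t)%N, (minn (e j.+1 - t) n); split.
    + lia.
    + lia.
    + move=> i iltn; case: (tauP (t + i)) => [[j' j'i ->]|[/(_ j) nji ->]].
        have jj' := uniq_window _ _ _ _ _ _ nt iltn i0n j'i ji0.
        rewrite jj' in j'i *.
        by case: ifP => // /negP; lia.
      by case: ifP => //; lia.
  exists 0%N, 0%N, 0%N; split=> // i iltn; rewrite ltn0 andbF.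
  case: (tauP (t + i)) => [[j ji _]|[]//].
  by case: nw; exists i; split=> //; exists j.
Qed.

(** * Product recurrent points are distal *)

Section nondistal.
Context {R : realType} {X : metricType R} (f : X -> X).
Context (cX : compact [set: X]) (cf : continuous f).

(** Only finitely many iterates are involved, and those with [f^a z] outside the open ball impose
    nothing. *)
Lemma exists_radius (z : X) (r : R) (k : nat) : exists2 d : R, 0 < d &
  forall a, (a < k)%N -> mdist (iter a f z) z < r ->
    forall v, mdist v z < d -> mdist (iter a f v) z < r.
Proof.
elim: k => [|k [d d0 dP]]; first by exists 1.
have [zr|rz] := ltP (mdist (iter k f z) z) r; last first.
  exists d => // a; rewrite ltnS leq_eqVlt => /orP[/eqP->|/dP//].
  by rewrite ltNge rz.
have e0 : 0 < r - mdist (iter k f z) z by rewrite subr_gt0.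
have [d' d'0 d'P] :=
  compact_uniformly_continuous cX (continuous_iter (n := k) cf) e0.
exists (Num.min d d') => [|a]; first by rewrite lt_min d0.
rewrite ltnS leq_eqVlt => /orP[/eqP->|ak] az v; rewrite lt_min => /andP[vd vd'].
  rewrite (le_lt_trans (metric_triangle _ (iter k f z) _))//.
  by rewrite -ltrBrDr d'P.
exact: dP vd.
Qed.

Lemma spanned_orbit (x z : X) : closure (orbit_plus f x) z ->
  htop_on f (closure (orbit_plus f x)) = 0%E ->
  forall e h : R, 0 < e -> 0 < h -> exists N, forall n, (N <= n)%N ->
    spanned f z n e (expR (h * n%:R)).
Proof.
move=> cz hf e h e0 h0.
have [|N NP] := zero_entropy_spanning _ hf e0 h0; first by exists z.
exists N => n /NP [m [g [mB gP]]]; exists m, g; split=> // q; apply: gP.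
move=> U /(continuous_iter cf) /cz [_ [[i _ <-] Ui]].
exists (iter q f (iter i f x)); split=> //; exists (q + i)%N => //.
by rewrite iterD.
Qed.

Lemma PR0_ps_distal (x : X) :
  htop_on f (closure (orbit_plus f x)) = 0%E -> PR0 F_ps f x -> distal f x.
Proof.
move=> hf PRx; apply: contrapT => /(nondistal_witness cX cf).
move=> [z [zx cz close synd]].
(* A simultaneous return will bound [mdist x z] by three distances less than [r], through [f^n x]
   and [f^n z]. *)
pose r := mdist x z / 4.
have r0 : 0 < r by rewrite divr_gt0// mdist_gt0; apply/eqP => /esym.
have [rho rhoP] : {rho : nat -> R & forall k, 0 < rho k /\
    forall a, (a < k)%N -> mdist (iter a f z) z < r ->
      forall v, mdist v z < rho k -> mdist (iter a f v) z < r}.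
  apply: (@choice _ _ (fun k d => 0 < d /\
    forall a, (a < k)%N -> mdist (iter a f z) z < r ->
      forall v, mdist v z < d -> mdist (iter a f v) z < r)) => k.
  by have [d d0 dP] := exists_radius z r k; exists d.
have rho0 k : 0 < rho k by have [] := rhoP k.
have span := spanned_orbit cz hf.
(* The spacing is chosen after [rho k], beyond the time from which spanning sets of precision
   [rho k / k.+1] grow at rate at most [1 / k.+1]. *)
have [M MP] : {M : nat -> nat & forall k, (2 * k + 2 <= M k)%N /\
    forall n, (M k <= n)%N ->
      spanned f z n (k.+1%:R^-1 * rho k) (expR (k.+1%:R^-1 * n%:R))}.
  apply: (@choice _ _ (fun k m => (2 * k + 2 <= m)%N /\
    forall n, (m <= n)%N ->
      spanned f z n (k.+1%:R^-1 * rho k) (expR (k.+1%:R^-1 * n%:R)))) => k.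
  have k0 : 0 < k.+1%:R^-1 :> R by rewrite invr_gt0.
  have [N NP] := span _ _ (mulr_gt0 k0 (rho0 k)) k0.
  by exists (maxn (2 * k + 2) N); split=> [|n]; [lia|rewrite geq_max => /andP[_ /NP]].
have Mk k : (2 * k + 2 <= M k)%N by have [] := MP k.
have Mspan k := (MP k).2.
have [tau [tauP tau_thick tau_window]] := exists_windows M
  (P := fun t => mdist (iter t f x) (iter t f z) < r) (fun N l => close r N l r0).
have tauM t k : tau t = Some k -> (M k <= t)%N by move=> /tauP [].
pose y := copies f z rho M tau.
have y01 i : 0 <= y i <= 1 by exact: copies01.
(* Hence [y] is not constant and its hull has more than one point. *)
have y1 : y 1%N = 0.
  rewrite /y copiesE//; case tauE : (tau 1%N) => [k|//].
  by have := tauM _ _ tauE; have := Mk k; lia.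
have tdsY : is_tds (@hull_shift R y).
  by apply: (shift_is_tds y01); exists 1%N; rewrite y1 /y copies0 eq_sym oner_neq0.
have hY : htop (@hull_shift R y) = 0%E.
  apply: (shift_zero_entropy y01) => e h e0 h0.
  exact: (copies_words_covered rho0 Mk tauM tau_window span Mspan e0 h0).
have psY : family_recurrent F_ps (@hull_shift R y) (hull_base y01).
  move=> U /nbhs_ballP[e /= e0 eU].
  have e20 : 0 < e / 2 by rewrite divr_gt0.
  pose k := (Num.bound (e / 2)^-1).+1.
  have ek i : (k <= i)%N -> 1 <= e / 2 * i.+1%:R.
    move=> ki; rewrite mulrC -ler_pdivrMr// div1r.
    rewrite (le_trans (ltW (archi_boundP _))) ?invr_ge0 ?(ltW e20)// ler_nat.
    by rewrite ltnW// ltnS ltnW.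
  have M0 := M_gt0 Mk k.
  (* At such times [n], the first [k] coordinates of the shifted sequence are those of [y] times a
     weight above [1 - e / 2]; by the choice of [k] the others are negligible. *)
  apply: (@piecewise_syndeticS _
    [set n | (M k %| n)%N /\ mdist (iter n f z) z < e / 2 * rho k]
    [set n | forall i, (i < k)%N -> tau (n + i)%N = Some k]).
  - by apply: synd => //; rewrite mulr_gt0.
  - move=> n; have [m mT] := tau_thick k (n + k)%N; exists m => i iltn j jk /=.
    by rewrite -addnA; apply: mT; lia.
  - move=> n [[Mn nz] taun]; have n0 : (0 < n)%N.
      by have := taun 0%N isT; rewrite addn0 => /tauM; lia.
    split=> //; apply: eU; rewrite ballEmdist /= metric_sym.
    apply: (@le_lt_trans _ _ (e / 2)); last by lra.
    apply/hull_distP => i; rewrite iter_shiftE /=.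
    have [ik|ki] := ltnP i k; last first.
      apply: le_trans (ek _ ki); have := y01 (n + i)%N; have := y01 i.
      by move=> /andP[? ?] /andP[? ?]; rewrite ler_norml; lra.
    have /andP[yi0 yi1] := y01 i.
    have [q nE] := dvdnP Mn.
    have iM : (i < M k)%N by have := Mk k; lia.
    have -> : y (n + i)%N = tent z rho k (iter n f z) * y i.
      rewrite /y copiesE//; last by rewrite addn_gt0 n0.
      rewrite taun// nE modnMDl divnMDl// modn_small// ik divn_small// addn0.
      by rewrite [(M k * q)%N]mulnC.
    rewrite distrC -{1}(mul1r (y i)) -mulrBl ger0_norm; last first.
      by rewrite mulr_ge0// subr_ge0 tent_le1.
    apply: (@le_trans _ _ (e / 2)); last by rewrite ler_peMr ?ler1n// ltW.
    apply: (@le_trans _ _ (1 - tent z rho k (iter n f z))).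
      by rewrite ler_piMr// subr_ge0 tent_le1.
    rewrite lerBlDl -lerBlDr (le_trans _ (tent_ge _ _ _ _))// lerD2l lerN2.
    by rewrite ler_pdivrMr// ltW.
have /(_ (ball x r `*` ball (hull_base y01) 1)) [|n [n0 [xn yn]]] :=
    PRx _ _ tdsY hY _ psY.
  exists (ball x r, ball (hull_base y01) 1) => //; split; exact: nbhsx_ballx.
have iterE : iter n (prod_map f (@hull_shift R y)) (x, hull_base y01) =
    (iter n f x, iter n (@hull_shift R y) (hull_base y01)).
  by elim: n {n0 xn yn} => //= n ->.
move: xn yn; rewrite iterE !ballEmdist /= => xn yn.
(* As [y 0 = 1], a zero at [n] would put the shifted sequence at distance at least 1. *)
have yn0 : y n != 0.
  apply/eqP => yn0.
  have := hull_dist_coord (hull_base y01)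
    (iter n (@hull_shift R y) (hull_base y01)) 0.
  rewrite iter_shiftE addn0 /= yn0 /y copies0 subr0 normr1 mulr1.
  by rewrite leNgt yn.
have nz := copies_neq0_close rho0 Mk tauM r0 (fun k => (rhoP k).2) yn0.
have [k /tauP [_ xz]] := copies_tau Mk tauM n0 yn0.
have : mdist x z < 4 * r.
  rewrite (le_lt_trans (metric_triangle _ (iter n f x) _))//.
  have := metric_triangle (iter n f x) (iter n f z) z; lra.
by rewrite /r mulrC divfK ?ltxx.
Qed.

End nondistal.

Theorem theorem1p3 (R : realType) (X : metricType R) (f : X -> X) (x : X)
    (tdsf : is_tds f) (hf : htop_on f (closure (orbit_plus f x)) = 0%E) :
  [<-> distal f x;
       PR0 F_inf f x;
       PR0 (F_pubd R) f x;
       PR0 F_ps f x].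
Proof.
have [cX _ cf] := tdsf; tfae.
- move=> dx Y g [cY _ cg] _ y Fy; apply: distal_product_recurrent => //.
  move=> U /Fy Uinf; apply: contrapT => U0; apply: Uinf.
  suff -> : hitting_times g y U = set0 by exact: finite_set0.
  by apply/seteqP; split=> // n Un; apply: U0; exists n.
- exact: PR0S (@F_pubd_inf R).
- exact: PR0S (@F_ps_pubd R).
- exact: PR0_ps_distal.
Qed.
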